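(* Let $m\ge 2$ and let $K\ne\Delta_{[m]}$ be a simplicial complex on $[m]$. Then $\mathrm{Bier}(K)$ is chordal if and only if $\mathrm{Bier}(K)$ is polytopal and one of the following holds: $m=2$ and $P_K=\Delta^1$; $m=3$ and $P_K=\Delta^2$ (a triangle); or $m\ge 4$ and $P_K$ is a truncation polytope of type $\mathrm{vc}^k(\Delta^{m-1})$ for some $0\le k\le m$.
   Context: A simplicial complex $K$ on $[m]=\{1,\dots,m\}$ is a nonempty family of subsets of $[m]$ closed under taking subsets. $\Delta_{[m]}=2^{[m]}$. Let $[m']=\{1',\dots,m'\}$ be a disjoint copy of $[m]$, $I'=\{i':i\in I\}$. For $K\ne\Delta_{[m]}$ the Alexander dual $K^\vee$ is the complex on $[m']$ with $J'\in K^\vee$ iff $[m]\setminus J\notin K$. The Bier sphere $\mathrm{Bier}(K)$ is the complex on $[m]\sqcup[m']$ with faces $I\sqcup J'$, $I\in K$, $J'\in K^\vee$, $I\cap J=\varnothing$; it is an $(m-2)$-dimensional PL sphere. $\mathrm{Bier}(K)$ is polytopal if it is simplicially isomorphic to the boundary complex of a convex simplicial polytope; then $P_K$ denotes a simple $(m-1)$-polytope whose dual $P_K^*$ has boundary complex isomorphic to $\mathrm{Bier}(K)$; equalities $P_K=Q$ mean combinatorial equivalence. A truncation polytope of type $\mathrm{vc}^k(\Delta^n)$ is a polytope combinatorially equivalent to a convex simple $n$-polytope obtained from the $n$-simplex $\Delta^n$ by a sequence of $k$ vertex truncations by hyperplanes in general position. A graph is chordal if it has no induced cycle of length greater than $3$;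 a simplicial complex is chordal if its 1-skeleton is a chordal graph. *)

(* Defs.v *)
From HB Require Import structures.
From mathcomp Require Import all_boot all_order all_algebra.
From mathcomp Require Import boolp classical_sets reals.
Set Implicit Arguments. Unset Strict Implicit. Unset Printing Implicit Defensive.
Import Order.TTheory GRing.Theory Num.Theory.
Local Open Scope ring_scope.

Definition simplicial_complex (T : finType) (K : {set {set T}}) : Prop :=
  (exists A, A \in K) /\ (forall A B : {set T}, B \subset A -> A \in K -> B \in K).

(* Alexander dual, on the copy [m'] (represented again by 'I_m) *)
Definition alexander_dual (m : nat) (K : {set {set 'I_m}}) : {set {set 'I_m}} :=
  [set J : {set 'I_m} | ~: J \notin K].

Definition bier (m : nat) (K : {set {set 'I_m}}) : {set {set ('I_m + 'I_m)%type}} :=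
  [set A : {set ('I_m + 'I_m)%type} |
     let I := [set i | inl i \in A] in
     let J := [set j | inr j \in A] in
     [&& I \in K, J \in alexander_dual K & [disjoint I & J]]].

Definition skel_edge (T : finType) (C : {set {set T}}) (x y : T) : bool :=
  (x != y) && ([set x; y] \in C).

Definition cyc_consec (l i j : nat) : bool :=
  (j == (i.+1 %% l)%N) || (i == (j.+1 %% l)%N).

Definition chordal_graph (T : finType) (e : rel T) : Prop :=
  ~ exists (x0 : T) (s : seq T), [/\ (4 <= size s)%N, uniq s &
      forall i j, (i < size s)%N -> (j < size s)%N -> i <> j ->
        (e (nth x0 s i) (nth x0 s j) <-> cyc_consec (size s) i j)].

Definition chordal_complex (T : finType) (C : {set {set T}}) : Prop :=
  chordal_graph (skel_edge C).

Section Geometry.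
Variable R : realType.
Local Open Scope classical_set_scope.

Definition dotv (n : nat) (u v : 'rV[R]_n) : R := \sum_(i < n) u 0 i * v 0 i.

Definition conv (n : nat) (V : seq 'rV[R]_n) : set 'rV[R]_n :=
  [set x | exists c : 'rV[R]_n -> R, [/\ forall p, 0 <= c p,
       \sum_(p <- V) c p = 1 & x = \sum_(p <- V) c p *: p]].

(* faces of a convex set S: S itself, and the intersections of S with
   supporting hyperplanes (this includes the empty face) *)
Definition face (n : nat) (S F : set 'rV[R]_n) : Prop :=
  F = S \/ exists (a : 'rV[R]_n) (b : R),
    (forall x, S x -> dotv a x <= b) /\ F = [set x | S x /\ dotv a x = b].

Definition vertex (n : nat) (S : set 'rV[R]_n) (p : 'rV[R]_n) : Prop :=
  face S [set p].

Definition aff_indep_in (n : nat) (V : seq 'rV[R]_n) (P : set 'rV[R]_n) : Prop :=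
  forall c : 'rV[R]_n -> R,
    \sum_(p <- undup V | `[< P p >]) c p = 0 ->
    \sum_(p <- undup V | `[< P p >]) c p *: p = 0 ->
    forall p, p \in V -> P p -> c p = 0.

Definition simplicial_polytope (n : nat) (V : seq 'rV[R]_n) : Prop :=
  forall F, face (conv V) F -> F <> conv V ->
    aff_indep_in V [set p | vertex (conv V) p /\ F p].

Definition iso_boundary (T : finType) (C : {set {set T}}) (n : nat)
    (V : seq 'rV[R]_n) (phi : T -> 'rV[R]_n) : Prop :=
  [/\ forall x y, [set x]%SET \in C -> [set y]%SET \in C -> phi x = phi y -> x = y,
      forall p, vertex (conv V) p <-> exists x, [set x]%SET \in C /\ phi x = p &
      forall A : {set T}, (forall x, x \in A -> [set x]%SET \in C) ->
        (A \in C <-> exists F, [/\ face (conv V) F, F <> conv V &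
            [set p | vertex (conv V) p /\ F p] = phi @` [set x | x \in A]])].

Definition face_antiiso (n p : nat) (P : set 'rV[R]_n) (Q : set 'rV[R]_p) : Prop :=
  exists f : set 'rV[R]_n -> set 'rV[R]_p,
    [/\ forall F, face P F -> face Q (f F),
        forall G, face Q G -> exists F, face P F /\ f F = G &
        forall F G, face P F -> face P G -> (F `<=` G <-> f G `<=` f F)].

Definition simplex_set (n : nat) (S : set 'rV[R]_n) : Prop :=
  exists v : 'I_n.+1 -> 'rV[R]_n,
    (forall c : 'I_n.+1 -> R, \sum_i c i = 0 -> \sum_i c i *: v i = 0 ->
        forall i, c i = 0) /\
    S = conv (map v (enum 'I_n.+1)).

Inductive truncated (n : nat) : nat -> set 'rV[R]_n -> Prop :=
| trunc0 S : simplex_set S -> @truncated n 0%N S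
| truncS k S v (a : 'rV[R]_n) (b : R) :
    @truncated n k S -> vertex S v -> b < dotv a v ->
    (forall w, w <> v -> vertex S w -> dotv a w < b) ->
    @truncated n k.+1 (S `&` [set x | dotv a x <= b]).

End Geometry.

(* Main.v *)
Require Import Defs.
From HB Require Import structures.
From mathcomp Require Import all_boot all_order all_algebra.
From mathcomp Require Import boolp classical_sets reals.
From mathcomp Require Import zify ring lra.
From mathcomp Require Import fintype finset.
Import Order.TTheory GRing.Theory Num.Theory.
Set Implicit Arguments.
Unset Strict Implicit.
Unset Printing Implicit Defensive.

(** A short search for induced cycles of length 4 and 5 shows that, for m >= 3,
    Bier(K) can only be chordal if K contains every ([m] minus two points) or,
    dually, no edge. In the first case Bier(K) is the boundary of a simplex some
    of whose facets, those [m] minus s that are not in K, are stellarly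
    subdivided; the dual polytope is a simplex with the corresponding vertices
    cut off. The second case reduces to the first since Bier(K) and Bier(K^dual)
    differ by the swap of [m] and [m'].

    Conversely, the facets of P_K correspond to the vertices of Bier(K), two of
    them meeting iff the vertices are adjacent. A vertex truncation in dimension
    at least 3 adds to this graph one vertex, whose neighbours all contain the
    truncated vertex and therefore form a clique, so chordality persists. *)

(** * Chordal Bier spheres *)

(** Both directions work with systems of inequalities instead of face lattices. For the converse, a
    polytope is carried as a finite system whose normals active at any point are linearly
    independent. Truncation keeps this property because no vertex lies on the cutting hyperplane.
    For the realization, vertices of Bier(K) become explicit vectors, and its faces are recognised
    as the sets of vectors x with <x,y> = 1, for y in the polar. Membership in Bier(K) then amounts
    to distributing the total m over m nonnegative slacks.

    The dimension decides what is possible. From dimension 3 on, two facets meeting at a vertex also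
    meet at a second one, so they still touch when the first is cut off. In dimension 2 cutting a
    corner separates its two sides, which is why m = 3 admits only the triangle; there the cycles of
    length 4, 5 and 6 have to be excluded separately. For m = 2 the complement of a pair is empty,
    so nothing forces the singletons into K, and this case is realized by hand. *)

Section InducedCycles.
Variables (T : finType) (e : rel T).
Hypothesis esym : symmetric e.

Lemma induced4_nchordal a b c d : uniq [:: a; b; c; d] ->
  e a b -> e b c -> e c d -> e d a -> ~~ e a c -> ~~ e b d ->
  ~ chordal_graph e.
Proof.
move=> U ab bc cd da /negPf nac /negPf nbd.
apply; exists a, [:: a; b; c; d]; split=> //.
by case=> [|[|[|[|?]]]] [|[|[|[|?]]]] //= _ _ _; rewrite /cyc_consec /=;
  first [rewrite ab|rewrite bc|rewrite cd|rewrite da|rewrite nac|rewrite nbd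
        |rewrite esym ?ab ?bc ?cd ?da ?nac ?nbd].
Qed.

Lemma induced5_nchordal a b c d f : uniq [:: a; b; c; d; f] ->
  e a b -> e b c -> e c d -> e d f -> e f a ->
  ~~ e a c -> ~~ e a d -> ~~ e b d -> ~~ e b f -> ~~ e c f ->
  ~ chordal_graph e.
Proof.
move=> U ab bc cd df fa /negPf nac /negPf nad /negPf nbd /negPf nbf /negPf ncf.
apply; exists a, [:: a; b; c; d; f]; split=> //.
by case=> [|[|[|[|[|?]]]]] [|[|[|[|[|?]]]]] //= _ _ _; rewrite /cyc_consec /=;
  first [rewrite ab|rewrite bc|rewrite cd|rewrite df|rewrite fa
        |rewrite nac|rewrite nad|rewrite nbd|rewrite nbf|rewrite ncf
        |rewrite esym ?ab ?bc ?cd ?df ?fa ?nac ?nad ?nbd ?nbf ?ncf].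
Qed.

Lemma induced6_nchordal a b c d f g : uniq [:: a; b; c; d; f; g] ->
  e a b -> e b c -> e c d -> e d f -> e f g -> e g a ->
  ~~ e a c -> ~~ e a d -> ~~ e a f -> ~~ e b d -> ~~ e b f -> ~~ e b g ->
  ~~ e c f -> ~~ e c g -> ~~ e d g ->
  ~ chordal_graph e.
Proof.
move=> U ab bc cd df fg ga /negPf nac /negPf nad /negPf naf /negPf nbd.
move=> /negPf nbf /negPf nbg /negPf ncf /negPf ncg /negPf ndg.
apply; exists a, [:: a; b; c; d; f; g]; split=> //.
by case=> [|[|[|[|[|[|?]]]]]] [|[|[|[|[|[|?]]]]]] //= _ _ _;
  rewrite /cyc_consec /=;
  first [rewrite ab|rewrite bc|rewrite cd|rewrite df|rewrite fg|rewrite ga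
        |rewrite nac|rewrite nad|rewrite naf|rewrite nbd|rewrite nbf
        |rewrite nbg|rewrite ncf|rewrite ncg|rewrite ndg
        |rewrite esym ?ab ?bc ?cd ?df ?fg ?ga ?nac ?nad ?naf ?nbd ?nbf ?nbg
           ?ncf ?ncg ?ndg].
Qed.

End InducedCycles.

Lemma skel_edge_sym (T : finType) (C : {set {set T}}) : symmetric (skel_edge C).
Proof. by move=> x y; rewrite /skel_edge eq_sym setUC. Qed.

Ltac uniq_sum :=
  rewrite /= ?inE ?negb_or ?andbT; repeat (apply/andP; split=> //); try done;
  apply/negP => /eqP [];
  match goal with H : is_true (?a != ?b) |- ?a = ?b -> _ =>
    let h := fresh in move=> h; by rewrite h eqxx in H end.

(** * Edges of a Bier sphere and the short cycles they force *)

Section BierEdges.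
Variables (m : nat) (K : {set {set 'I_m}}).
Hypotheses (Kc : simplicial_complex K) (KnT : K != powerset [set: 'I_m]).

Lemma complex_down (A B : {set 'I_m}) : B \subset A -> A \in K -> B \in K.
Proof. exact: Kc.2. Qed.

Lemma complex_set0 : set0 \in K.
Proof. by case: Kc.1 => A; apply: complex_down; exact: sub0set. Qed.

Lemma complex_setT : [set: 'I_m] \notin K.
Proof.
apply: contra KnT => H; apply/eqP/setP => A; rewrite !inE subsetT.
exact: complex_down (subsetT A) H.
Qed.

Lemma alexander_dual_complex : simplicial_complex (alexander_dual K).
Proof.
split; first by exists set0; rewrite inE setC0 complex_setT.
move=> A B AB; rewrite !inE; apply: contra; apply: complex_down.
by rewrite setCS.
Qed.

Lemma alexander_dual_neqT : alexander_dual K != powerset [set: 'I_m].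
Proof.
by apply/eqP => /setP /(_ [set: 'I_m]); rewrite !inE setCT complex_set0 subxx.
Qed.

Lemma bierE (A : {set 'I_m + 'I_m}) :
  (A \in bier K) = [&& [set i | inl i \in A] \in K,
     ~: [set j | inr j \in A] \notin K &
     [disjoint [set i | inl i \in A] & [set j | inr j \in A]]].
Proof. by rewrite /bier in_set /= /alexander_dual [in X in _ && X]in_set. Qed.

Lemma bier_down (A B : {set 'I_m + 'I_m}) :
  B \subset A -> A \in bier K -> B \in bier K.
Proof.
move=> /subsetP BA; rewrite !bierE => /and3P[h1 h2 h3].
have s1 : [set i | inl i \in B] \subset [set i | inl i \in A].
  by apply/subsetP => i; rewrite !inE => /BA.
have s2 : [set i | inr i \in B] \subset [set i | inr i \in A].
  by apply/subsetP => i; rewrite !inE => /BA.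
apply/and3P; split.
- exact: complex_down s1 h1.
- by apply: contra h2; apply: complex_down; rewrite setCS.
- apply: disjointWl s1 _; exact: disjointWr s2 _.
Qed.

Lemma bier_inl (i : 'I_m) : ([set inl i] \in bier K) = ([set i] \in K).
Proof.
rewrite bierE.
have -> : [set k | inl k \in [set (inl i : 'I_m + 'I_m)]] = [set i].
  by apply/setP => k; rewrite !inE.
have -> : [set k | inr k \in [set (inl i : 'I_m + 'I_m)]] = set0.
  by apply/setP => k; rewrite !inE.
by rewrite setC0 complex_setT -setI_eq0 setI0 eqxx !andbT.
Qed.

Lemma bier_inr (i : 'I_m) : ([set inr i] \in bier K) = (~: [set i] \notin K).
Proof.
rewrite bierE.
have -> : [set k | inl k \in [set (inr i : 'I_m + 'I_m)]] = set0.
  by apply/setP => k; rewrite !inE.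
have -> : [set k | inr k \in [set (inr i : 'I_m + 'I_m)]] = [set i].
  by apply/setP => k; rewrite !inE.
by rewrite complex_set0 -setI_eq0 set0I eqxx !andbT.
Qed.

Lemma bier_edge_ll (i j : 'I_m) : 
  skel_edge (bier K) (inl i) (inl j) = (i != j) && ([set i; j] \in K).
Proof.
rewrite /skel_edge bierE; congr andb.
have -> : [set k | inl k \in [set (inl i : 'I_m + 'I_m); inl j]] = [set i; j].
  by apply/setP => k; rewrite !inE.
have -> : [set k | inr k \in [set (inl i : 'I_m + 'I_m); inl j]] = set0.
  by apply/setP => k; rewrite !inE.
by rewrite setC0 complex_setT -setI_eq0 setI0 eqxx !andbT.
Qed.

Lemma bier_edge_rr (i j : 'I_m) : 
  skel_edge (bier K) (inr i) (inr j) = (i != j) && (~: [set i; j] \notin K).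
Proof.
rewrite /skel_edge bierE; congr andb.
have -> : [set k | inr k \in [set (inr i : 'I_m + 'I_m); inr j]] = [set i; j].
  by apply/setP => k; rewrite !inE.
have -> : [set k | inl k \in [set (inr i : 'I_m + 'I_m); inr j]] = set0.
  by apply/setP => k; rewrite !inE.
by rewrite complex_set0 -setI_eq0 set0I eqxx !andbT.
Qed.

Lemma bier_edge_lr (i j : 'I_m) : 
  skel_edge (bier K) (inl i) (inr j) =
    [&& i != j, [set i] \in K & ~: [set j] \notin K].
Proof.
rewrite /skel_edge bierE.
have -> : [set k | inl k \in [set (inl i : 'I_m + 'I_m); inr j]] = [set i].
  by apply/setP => k; rewrite !inE orbF.
have -> : [set k | inr k \in [set (inl i : 'I_m + 'I_m); inr j]] = [set j].
  by apply/setP => k; rewrite !inE.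
by rewrite disjoints1 inE; case: (i == j); rewrite /= ?andbF ?andbT.
Qed.

Lemma bier_edge_rl (i j : 'I_m) : 
  skel_edge (bier K) (inr j) (inl i) =
    [&& i != j, [set i] \in K & ~: [set j] \notin K].
Proof. by rewrite skel_edge_sym bier_edge_lr. Qed.

Definition bier_edgeE :=
  (bier_edge_ll, bier_edge_rr, bier_edge_lr, bier_edge_rl).

Hypothesis chK : chordal_complex (bier K).

Lemma complex_pairl (i j : 'I_m) : [set i; j] \in K -> [set i] \in K.
Proof. by apply: complex_down; rewrite subsetUl. Qed.

Lemma complex_pairr (i j : 'I_m) : [set i; j] \in K -> [set j] \in K.
Proof. by apply: complex_down; rewrite subsetUr. Qed.

Lemma complexC_pairl (i j : 'I_m) : ~: [set i; j] \notin K -> ~: [set i] \notin K.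
Proof. by apply: contra; apply: complex_down; rewrite setCS subsetUl. Qed.

Lemma complexC_pairr (i j : 'I_m) : ~: [set i; j] \notin K -> ~: [set j] \notin K.
Proof. by rewrite setUC; apply: complexC_pairl. Qed.

(** Otherwise i, j, i', j' is an induced 4-cycle: its diagonals join a vertex to its own copy, and
    such a pair is never an edge. *)
Lemma chordal_same_pair (i j : 'I_m) : i != j -> [set i; j] \in K ->
  ~: [set i; j] \in K.
Proof.
move=> ij Kij; apply: contraT => Dij; exfalso.
have ji : j != i by rewrite eq_sym.
have Ki := complex_pairl Kij; have Kj := complex_pairr Kij.
have Di := complexC_pairl Dij; have Dj := complexC_pairr Dij.
move: chK; apply: (@induced4_nchordal _ _ (@skel_edge_sym _ (bier K))
  (inl i) (inl j) (inr i) (inr j)).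
all: rewrite ?bier_edgeE ?eqxx //=.
- uniq_sum.
- by rewrite ij.
- by rewrite ji Kj Di.
- by rewrite ij.
- by rewrite ij Ki Dj.
Qed.

(** If {i,l} were in K, then so would be the complement of {i,l}, whereas {i,j} would not. The
    induced cycle is then i, l, j, l' or i, l, i', j, l', according to whether {j,l} is in K. *)
Lemma chordal_adjacent_pairs (i j l : 'I_m) : i != j -> i != l -> j != l ->
  ~: [set i; j] \notin K -> [set i; l] \notin K.
Proof.
move=> ij il jl Dij; apply/negP => Kil.
have [ji li lj] : [/\ j != i, l != i & l != j] by rewrite ![_ == i]eq_sym (eq_sym l).
have Dil := chordal_same_pair il Kil.
have Ki := complex_pairl Kil; have Kl := complex_pairr Kil.
have Kj : [set j] \in K.
  by apply: complex_down Dil; rewrite sub1set !inE negb_or ji jl.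
have Di := complexC_pairl Dij; have Dj := complexC_pairr Dij.
have Kij : [set i; j] \notin K by apply: contra Dij => /(chordal_same_pair ij).
have Dl : ~: [set l] \notin K.
  apply: contra Kij; apply: complex_down; apply/subsetP => k.
  by rewrite !inE => /orP[] /eqP ->.
case: (boolP ([set j; l] \in K)) => Kjl.
  move: chK; apply: (@induced4_nchordal _ _ (@skel_edge_sym _ (bier K))
    (inl i) (inl l) (inl j) (inr l)).
  all: rewrite ?bier_edgeE ?eqxx //= ?il ?jl ?lj ?Kil ?Ki ?Kj ?Dl ?andbT //=.
- uniq_sum.
  - by rewrite setUC.
  - by rewrite negb_and Kij orbT.
move: chK; apply: (@induced5_nchordal _ _ (@skel_edge_sym _ (bier K))
    (inl i) (inl l) (inr i) (inl j) (inr l)).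
all: rewrite ?bier_edgeE ?eqxx //= ?il ?jl ?lj ?Kil ?Ki ?Kj ?Kl ?Dl ?Di ?Dil ?li ?ji ?andbT //=.
- uniq_sum.
- by rewrite negb_and Kij orbT.
- by rewrite setUC.
Qed.

(** If both alternatives fail, there are an edge {i',j'} of the dual and an edge {k,l} of K, and by
    the preceding lemmas i, j, k, l are distinct. The edge {k,l} puts the complement of {k,i} into
    K, hence its subset {j,l}; the dual edge {i',j'} forbids {j,l}. *)
Lemma chordal_pairs :
  (forall i j, i != j -> ~: [set i; j] \in K) \/
  (forall i j, i != j -> [set i; j] \notin K).
Proof.
apply: contrapT => /not_orP[/existsNP[i /existsNP[j]] H1 /existsNP[k /existsNP[l]] H2].
have [ij /negP Dij] : i != j /\ ~ (~: [set i; j] \in K).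
  by split; [apply: contrapT => h; apply: H1 => /h|move=> h; apply: H1].
have [kl Kkl] : k != l /\ ([set k; l] \in K).
  split; first by apply: contrapT => h; apply: H2 => /h.
  by apply: contrapT => /negP h; apply: H2.
have share a b c : a != b -> ~: [set a; b] \notin K -> a != c -> [set a; c] \notin K.
  move=> ab Dab ac; have [->|bc] := eqVneq c b.
    by apply: contra Dab => /(chordal_same_pair ab).
  by apply: chordal_adjacent_pairs Dab => //; rewrite eq_sym.
have shareD a b c : a != b -> [set a; b] \in K -> a != c -> ~: [set a; c] \in K.
  by move=> ab Kab ac; apply: contraLR Kab => Dac; apply: share ac Dac ab.
have Dji : ~: [set j; i] \notin K by rewrite setUC.
have Klk : [set l; k] \in K by rewrite setUC.
have [ji lk] : j != i /\ l != k by rewrite eq_sym ij eq_sym kl.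
have ik : i != k by apply: contraTneq Kkl => ik; rewrite -ik in kl *; exact: share ij Dij kl.
have il : i != l.
  by apply: contraTneq Klk => il; rewrite -il in lk *; exact: share ij Dij lk.
have jk : j != k.
  by apply: contraTneq Kkl => jk; rewrite -jk in kl *; exact: share ji Dji kl.
have jl : j != l.
  by apply: contraTneq Klk => jl; rewrite -jl in lk *; exact: share ji Dji lk.
have Dki : ~: [set k; i] \in K by apply: shareD kl Kkl _; rewrite // eq_sym.
have : [set j; l] \notin K by apply: (@share j i l).
apply/negP/negPn; apply: complex_down Dki; apply/subsetP => x.
rewrite !inE => /orP[] /eqP ->; rewrite negb_or ?ji ?jk //.
by rewrite lk eq_sym il.
Qed.

End BierEdges.

Lemma setC_ord3 (s t u : 'I_3) : s != t -> s != u -> t != u ->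
  ~: [set s] = [set t; u].
Proof.
by case: s => [[|[|[|]]] ?]; case: t => [[|[|[|]]] ?]; case: u => [[|[|[|]]] ?] //;
 move=> _ _ _; apply/setP => -[[|[|[|]]] ?] //; rewrite !inE.
Qed.

(** Here K contains all three points, and Bier(K) is a circle in which every missing edge of K is
    subdivided by one primed vertex. If one edge is missing, the circle has length 4, 5 or 6; the
    cases list which of the other two are present. *)
Lemma chordal_ord3_edges (K : {set {set 'I_3}}) :
  simplicial_complex K -> K != powerset [set: 'I_3] ->
  chordal_complex (bier K) ->
  (forall i j, i != j -> ~: [set i; j] \in K) ->
  forall s, ~: [set s] \in K.
Proof.
move=> Kc KnT chK KD s; apply: contraT => Ds; exfalso.
have [t [u [st su tu]]] : exists t u, [/\ s != t, s != u & t != u].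
  case: s {Ds} => [[|[|[|]]] ?] //.
  - by exists (inord 1), (inord 2); rewrite -!val_eqE /= !inordK.
  - by exists (inord 0), (inord 2); rewrite -!val_eqE /= !inordK.
  - by exists (inord 0), (inord 1); rewrite -!val_eqE /= !inordK.
have [ts us ut] : [/\ t != s, u != s & u != t] by rewrite !(eq_sym u) eq_sym.
have Ds' := Ds; rewrite (setC_ord3 st su tu) in Ds'.
have Dt' := setC_ord3 ts tu su; have Du' := setC_ord3 us ut st.
have K1 (x : 'I_3) : [set x] \in K.
  case: (eqVneq s x) => [<-|sx].
    by apply: (complex_down Kc) (KD t u tu); rewrite sub1set !inE negb_or st su.
  case: (eqVneq t x) => [<-|tx].
    by apply: (complex_down Kc) (KD s u su); rewrite sub1set !inE negb_or ts tu.
  by apply: (complex_down Kc) (KD s t st); rewrite sub1set !inE negb_or !(eq_sym x) sx tx.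
have neqs := (st, su, tu, ts, us, ut).
have edgeE := bier_edgeE Kc KnT.
have es := @skel_edge_sym _ (bier K).
case: (boolP ([set s; t] \in K)) => Kst; case: (boolP ([set s; u] \in K)) => Ksu.
{ move: chK; apply: (induced4_nchordal es
    (a := inl s) (b := inl t) (c := inr s) (d := inl u)).
  all: rewrite ?edgeE ?eqxx ?neqs ?K1 ?Kst ?Ds //=.
  - uniq_sum.
  - by rewrite setUC. }
{ move: chK; apply: (induced5_nchordal es
    (a := inl s) (b := inl t) (c := inr s) (d := inl u) (f := inr t)).
  all: rewrite ?edgeE ?eqxx ?neqs ?K1 ?Kst ?Ds ?Dt' ?KD //=.
  uniq_sum. }
{ move: chK; apply: (induced5_nchordal es
    (a := inl s) (b := inl u) (c := inr s) (d := inl t) (f := inr u)).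
  all: rewrite ?edgeE ?eqxx ?neqs ?K1 ?Ksu ?Ds ?Du' ?KD //=.
  - uniq_sum.
  - by rewrite setUC. }
move: chK; apply: (induced6_nchordal es
  (a := inl s) (b := inr t) (c := inl u) (d := inr s) (f := inl t) (g := inr u)).
all: rewrite ?edgeE ?eqxx ?neqs ?K1 ?Ds ?Dt' ?Du' ?KD //=.
- uniq_sum.
- by rewrite setUC.
Qed.

(** * Chordality under induced embeddings and added simplicial vertices *)

Section ChordalGraphs.

(** Every vertex of a cycle has a neighbour, so an induced cycle lies in P, where g is an induced
    embedding. The predicate P is there for elements of T that are not vertices of the complex. *)
Lemma chordal_graph_transfer (T U : finType) (e : rel T) (e' : rel U)
    (P : T -> Prop) (g : T -> U) :
  (forall x y, e x y -> P x) ->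
  (forall x y, P x -> P y -> g x = g y -> x = y) ->
  (forall x y, P x -> P y -> x != y -> e x y <-> e' (g x) (g y)) ->
  chordal_graph e' -> chordal_graph e.
Proof.
move=> eP ginj ee' che' [x0 [s [s4 us cyc]]]; apply: che'.
have sP x : x \in s -> P x.
  move=> xs; have ix : (index x s < size s)%N by rewrite index_mem.
  have js : ((index x s).+1 %% size s < size s)%N by rewrite ltn_mod; lia.
  have /eP : e (nth x0 s (index x s)) (nth x0 s ((index x s).+1 %% size s)).
    apply/cyc => //; last by rewrite /cyc_consec eqxx.
    have [h|h] : (index x s).+1 = size s \/ ((index x s).+1 < size s)%N by lia.
      by rewrite h modnn; lia.
    by rewrite modn_small //; lia.
  by rewrite nth_index.
exists (g x0), (map g s); rewrite size_map; split=> //.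
  rewrite map_inj_in_uniq // => x y xs ys; exact: ginj (sP _ xs) (sP _ ys).
move=> i j si sj ij; rewrite !(nth_map x0) //; rewrite -cyc //.
apply: iff_sym; apply: ee'; try by apply: sP; rewrite mem_nth.
by rewrite nth_uniq //; apply/eqP.
Qed.

(** The neighbours of [None] form a clique, while on an induced cycle of length at least 4 the two
    neighbours of a vertex are not adjacent. Thus an induced cycle avoids [None] and comes from
    e. *)
Lemma chordal_graph_simplicial_vertex (T : finType) (e : rel T) (e' : rel (option T)) :
  symmetric e' ->
  (forall x y, x != y -> e' (Some x) (Some y) = e x y) ->
  (forall x y, x != y -> e' None (Some x) -> e' None (Some y) -> e x y) ->
  chordal_graph e -> chordal_graph e'.
Proof.
move=> es ee simp che [x0 [s [s4 us cyc]]].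
have [Ns|Ns] := boolP (None \in s); last first.
  have [s0 Es] : exists s0, s = map Some s0.
    elim: s Ns {s4 us cyc} => [|[x|] s IH] //=; first by exists [::].
    by rewrite inE /= => /IH[s0 ->]; exists (x :: s0).
  subst s; rewrite size_map in s4 cyc; apply: che.
  case: s0 us s4 cyc {Ns} => [|y s0] // us s4 cyc.
  exists y, (y :: s0); split=> //; first by move: us; rewrite map_inj_uniq // => ? ? [].
  move=> i j si sj ij; rewrite -cyc // !(nth_map y) // ee //.
  rewrite nth_uniq //; first exact/eqP.
  by move: us; rewrite map_inj_uniq // => ? ? [].
set l := size s in s4 cyc *; set p := index None s.
have pl : (p < l)%N by rewrite index_mem.
have np : nth x0 s p = None by rewrite nth_index.
(* These are the positions before and after p; the cases p = 0 and p = l - 1 are those that wrap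
   around. *)
have [i [j [[il jl ip jp] [ij ci cj cij]]]] : exists i j, 
    [/\ (i < l)%N, (j < l)%N, p <> i & p <> j] /\
    [/\ i <> j, cyc_consec l p i, cyc_consec l p j & ~~ cyc_consec l i j].
  have [p0|p0] := posnP p.
    exists 1%N, l.-1; rewrite /cyc_consec p0 prednK ?modnn ?modn_small; try lia.
    split; first by split; lia.
    by split; rewrite ?eqxx ?orbT //; lia.
  have [pl1|pl1] : p.+1 = l \/ (p.+1 < l)%N by lia.
    exists 0%N, p.-1; rewrite /cyc_consec prednK // pl1 modnn !modn_small; try lia.
    split; first by split; lia.
    by split; rewrite ?eqxx ?orbT //; lia.
  exists p.+1, p.-1; rewrite /cyc_consec prednK // (modn_small pl) (modn_small pl1).
  split; first by split; lia.
  split; rewrite ?eqxx ?orbT //; try lia.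
  have [h|h] : p.+2 = l \/ (p.+2 < l)%N by lia.
    by rewrite h modnn; lia.
  by rewrite modn_small //; lia.
have notN k : (k < l)%N -> p <> k -> exists x, nth x0 s k = Some x.
  move=> kl pk; case E : (nth x0 s k) => [x|]; first by exists x.
  by case: pk; apply/eqP; rewrite -(nth_uniq x0 pl kl us) np E.
have [x Ex] := notN i il ip; have [y Ey] := notN j jl jp.
have xy : x != y.
  apply/eqP => xy; case: ij; apply/eqP; rewrite -(nth_uniq x0 il jl us).
  by rewrite Ex Ey xy.
have eij : e' (nth x0 s i) (nth x0 s j).
  rewrite Ex Ey ee //; apply: simp => //.
    by rewrite -np -Ex; apply/cyc.
  by rewrite -np -Ey; apply/cyc.
by move: cij; rewrite (cyc i j il jl ij).1.
Qed.

End ChordalGraphs.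

From mathcomp Require Import classical_sets.
Local Open Scope classical_set_scope.
Local Open Scope ring_scope.

(** * Faces of polyhedra *)

Section Dot.
Variables (R : realType) (n : nat).
Implicit Types (u v w : 'rV[R]_n) (k : R).

Lemma dotvE u v : dotv u v = (u *m v^T) 0 0.
Proof. by rewrite mxE; apply: eq_bigr => i _; rewrite mxE. Qed.

Lemma dotvC u v : dotv u v = dotv v u.
Proof. by apply: eq_bigr => i _; rewrite mulrC. Qed.

Lemma dotvDl u v w : dotv (u + v) w = dotv u w + dotv v w.
Proof. by rewrite !dotvE mulmxDl mxE. Qed.

Lemma dotvDr u v w : dotv u (v + w) = dotv u v + dotv u w.
Proof. by rewrite !(dotvC u) dotvDl. Qed.

Lemma dotvZl k u v : dotv (k *: u) v = k * dotv u v.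
Proof. by rewrite !dotvE -scalemxAl mxE. Qed.

Lemma dotvZr k u v : dotv u (k *: v) = k * dotv u v.
Proof. by rewrite !(dotvC u) dotvZl. Qed.

Lemma dotvNl u v : dotv (- u) v = - dotv u v.
Proof. by rewrite -scaleN1r dotvZl mulN1r. Qed.

Lemma dotvNr u v : dotv u (- v) = - dotv u v.
Proof. by rewrite !(dotvC u) dotvNl. Qed.

Lemma dotvBr u v w : dotv u (v - w) = dotv u v - dotv u w.
Proof. by rewrite dotvDr dotvNr. Qed.

Lemma dot0v v : dotv 0 v = 0.
Proof. by rewrite -(scale0r 0) dotvZl mul0r. Qed.

Lemma dotv0 v : dotv v 0 = 0.
Proof. by rewrite dotvC dot0v. Qed.

Lemma dotv_suml (I : Type) (r : seq I) (P : pred I) (F : I -> 'rV[R]_n) v :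
  dotv (\sum_(i <- r | P i) F i) v = \sum_(i <- r | P i) dotv (F i) v.
Proof.
by apply: (big_morph (fun u => dotv u v)) => [u w|]; rewrite ?dotvDl ?dot0v.
Qed.

Lemma dotv_sumr (I : Type) (r : seq I) (P : pred I) (F : I -> 'rV[R]_n) v :
  dotv v (\sum_(i <- r | P i) F i) = \sum_(i <- r | P i) dotv v (F i).
Proof. by rewrite dotvC dotv_suml; apply: eq_bigr => i _; rewrite dotvC. Qed.

End Dot.

Section Faces.
Variables (R : realType) (n : nat).
Implicit Types (S F G : set 'rV[R]_n) (x y v c : 'rV[R]_n).

Lemma faceP S F : face S F <-> exists a b,
  (forall x, S x -> dotv a x <= b) /\ F = [set x | S x /\ dotv a x = b].
Proof.
split=> [[->|[a [b H]]]|[a [b H]]]; [|by exists a, b|by right; exists a, b].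
exists 0, 0; split=> [x|]; first by rewrite dot0v.
by apply/seteqP; split=> x /=; rewrite ?dot0v // => -[].
Qed.

Lemma face_sub S F : face S F -> F `<=` S.
Proof. by move=> /faceP[a [b [_ ->]]] x []. Qed.

Lemma face_set0 S : face S set0.
Proof.
apply/faceP; exists 0, 1; split=> [x|]; first by rewrite dot0v.
apply/seteqP; split=> x //= -[_]; rewrite dot0v => /eqP.
by rewrite eq_sym oner_eq0.
Qed.

Lemma faceI S F G : face S F -> face S G -> face S (F `&` G).
Proof.
move=> /faceP[a [b [H1 ->]]] /faceP[c [d [H2 ->]]].
apply/faceP; exists (a + c), (b + d); split=> [x Sx|].
  by rewrite dotvDl lerD ?H1 ?H2.
apply/seteqP; split=> x /=; rewrite dotvDl; first by move=> [[? ->] [? ->]].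
move=> [Sx]; have := H1 _ Sx; have := H2 _ Sx => h1 h2 h3.
by split; split=> //; lra.
Qed.

(* The points of the relative interior of [G] have this property. *)
Lemma exists_generic_point (I : eqType) (r : seq I) (a : I -> 'rV[R]_n) (b : I -> R) G :
  (forall x y, G x -> G y -> G (2^-1 *: (x + y))) ->
  (exists x, G x) ->
  (forall i x, i \in r -> G x -> dotv (a i) x <= b i) ->
  exists2 y, G y & forall i, i \in r -> dotv (a i) y = b i ->
    forall x, G x -> dotv (a i) x = b i.
Proof.
move=> cG G0; elim: r => [|i r IH] Gle; first by case: G0 => x; exists x.
have [|y Gy Hy] := IH; first by move=> j x jr; apply: Gle; rewrite inE jr orbT.
have [Hi|/existsNP[z /not_implyP[Gz Hz]]] :=
  pselect (forall x, G x -> dotv (a i) x = b i).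
  exists y => // j; rewrite inE => /predU1P[->|/Hy] //.
have lt_z : dotv (a i) z < b i by rewrite lt_neqAle Gle ?inE ?eqxx // andbT; apply/eqP.
have hy j : j \in i :: r -> dotv (a j) y <= b j by move=> ?; apply: Gle.
have hz j : j \in i :: r -> dotv (a j) z <= b j by move=> ?; apply: Gle.
exists (2^-1 *: (y + z)); first exact: cG.
move=> j jr; rewrite dotvZr dotvDr => E.
have := hy _ jr; have := hz _ jr => h1 h2.
have e1 : dotv (a j) y = b j by lra.
have e2 : dotv (a j) z = b j by lra.
move: jr; rewrite inE => /predU1P[ji|jr]; first by subst j; lra.
exact: Hy.
Qed.

Lemma exists_small_step (I : eqType) (r : seq I) (a : I -> 'rV[R]_n) (b : I -> R) x d :
  exists2 e : R, 0 < e & forall i, i \in r -> dotv (a i) x < b i ->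
    dotv (a i) (x + e *: d) < b i.
Proof.
elim: r => [|i r [e e0 IH]]; first by exists 1.
have [lt_i|nlt_i] := boolP (dotv (a i) x < b i); last first.
  exists e => // j; rewrite inE => /predU1P[->|/IH] //.
  by rewrite (negPf nlt_i).
set g := b i - dotv (a i) x; set q := `|dotv (a i) d| + 1.
have q0 : 0 < q by rewrite ltr_wpDl.
have g0 : 0 < g by rewrite subr_gt0.
have small f : 0 < f -> f <= g / q -> dotv (a i) (x + f *: d) < b i.
  move=> f0; rewrite ler_pdivlMr // dotvDr dotvZr => h.
  have : f * dotv (a i) d < f * q.
    by rewrite ltr_pM2l // /q; have := ler_norm (dotv (a i) d); lra.
  by rewrite /g in h; lra.
exists (Num.min e (g / q)); first by rewrite lt_min e0 divr_gt0.
move=> j; rewrite inE => /predU1P[-> _|jr ltj].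
  by apply: small; rewrite ?lt_min ?e0 ?divr_gt0 // ge_min lexx orbT.
have le_e : Num.min e (g / q) <= e by rewrite ge_min lexx.
have f0 : 0 < Num.min e (g / q) by rewrite lt_min e0 divr_gt0.
have := IH j jr ltj; rewrite !dotvDr !dotvZr => h.
have [h0|h0] := leP 0 (dotv (a j) d).
  by have := ler_wpM2r h0 le_e; lra.
by have : Num.min e (g / q) * dotv (a j) d < 0; [rewrite pmulr_rlt0|lra].
Qed.

End Faces.

Section Polyhedra.
Variables (R : realType) (n : nat) (I : finType) (a : I -> 'rV[R]_n) (b : I -> R).
Implicit Types (x y v w c d : 'rV[R]_n) (i j l : I) (A J : {set I}).

Definition polyhedron : set 'rV[R]_n := [set x | forall i, dotv (a i) x <= b i].

Definition active x : {set I} := [set i | dotv (a i) x == b i]%SET.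

(** Triviality of the recession cone, the form in which boundedness is used. *)
Definition bounded_normals := forall d, (forall i, dotv (a i) d <= 0) -> d = 0.

Definition spanning_normals A := forall d, (forall i, i \in A -> dotv (a i) d = 0) -> d = 0.

Definition free_normals A := forall k : I -> R,
  \sum_(i in A) k i *: a i = 0 -> forall i, i \in A -> k i = 0.

Definition facets_touch : rel I :=
  [rel i j | `[< exists x, [/\ polyhedron x, i \in active x & j \in active x] >]].

Lemma activeP i x : reflect (dotv (a i) x = b i) (i \in active x).
Proof. by rewrite inE; apply: eqP. Qed.

Lemma nactive_lt i x : polyhedron x -> i \notin active x -> dotv (a i) x < b i.
Proof. by move=> Px; rewrite inE => h; rewrite lt_neqAle h Px. Qed.

(** The matrix whose rows are the normals of A has full row rank, hence a right inverse. *)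
Lemma free_normals_dual A (k : I -> R) :
  free_normals A -> exists d, forall i, i \in A -> dotv (a i) d = k i.
Proof.
move=> fA; pose M := \matrix_(s < #|A|) a (enum_val s).
have rM : row_free M.
  rewrite -kermx_eq0; apply/rowV0P => u /sub_kermxP uM.
  pose f i := \sum_(s < #|A| | enum_val s == i) u 0 s.
  have fE s : f (enum_val s) = u 0 s.
    rewrite /f (eq_bigl (pred1 s)) ?big_pred1_eq // => t /=.
    by rewrite (inj_eq enum_val_inj).
  have f0 : \sum_(i in A) f i *: a i = 0.
    rewrite big_enum_val /= -[RHS]uM mulmx_sum_row.
    by apply: eq_bigr => s _; rewrite fE rowK.
  by apply/rowP => s; rewrite mxE -fE (fA _ f0) // enum_valP.
pose d := (pinvmx M *m \col_s k (enum_val s))^T.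
exists d => i iA; have E : a i = row (enum_rank_in iA i) M.
  by rewrite rowK enum_rankK_in.
rewrite dotvE /d trmxK E -row_mul mulmxA mulmxVp // mul1mx !mxE.
by rewrite enum_rankK_in.
Qed.

(** The place where dimension at least 3 enters: two rows have rank at most 2. *)
Lemma pair_normals_not_spanning i j :
  (2 < n)%N -> exists2 d, d != 0 & dotv (a i) d = 0 /\ dotv (a j) d = 0.
Proof.
move=> n2; pose M := col_mx (a i) (a j).
have : kermx M^T != 0.
  rewrite -mxrank_eq0 mxrank_ker mxrank_tr -lt0n subn_gt0.
  by apply: leq_ltn_trans n2; rewrite rank_leq_row.
move=> /rowV0Pn[d /sub_kermxP dM d0]; exists d => //.
have E : M *m d^T = 0 by rewrite -[LHS]trmxK trmx_mul trmxK dM trmx0.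
move: E; rewrite mul_col_mx => E.
have E1 : a i *m d^T = 0 by rewrite -(col_mxKu (a i *m d^T) (a j *m d^T)) E linear0.
have E2 : a j *m d^T = 0 by rewrite -(col_mxKd (a i *m d^T) (a j *m d^T)) E linear0.
by rewrite !dotvE E1 E2 !mxE.
Qed.

(** The sum of the inequalities of A is an equality only where each of them is one. *)
Lemma polyhedron_face A : face polyhedron [set x | polyhedron x /\ A \subset active x].
Proof.
apply/faceP; exists (\sum_(i in A) a i), (\sum_(i in A) b i); split=> [x Px|].
  by rewrite dotv_suml ler_sum.
apply/seteqP; split=> x /= [Px]; rewrite dotv_suml => H; split=> //.
  by apply: eq_bigr => i iA; apply/activeP; apply: (fintype.subsetP H).
apply/fintype.subsetP => i iA; apply/activeP; apply/eqP.
move/eqP: H; rewrite eq_le => /andP[_]; rewrite leNgt.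
apply: contraR => Hi; rewrite (bigD1 i) //= [X in _ < X](bigD1 i) //=.
by rewrite ltr_leD ?ler_sum // lt_neqAle Hi Px.
Qed.

Lemma free_interior x : polyhedron x -> free_normals (active x) ->
  exists y, forall i, dotv (a i) y < b i.
Proof.
move=> Px /(@free_normals_dual _ (fun=> -1))[d Hd].
have [e e0 He] := exists_small_step (enum I) a b x d.
exists (x + e *: d) => i; have [/[dup] /Hd di /activeP xi|ni] := boolP (i \in active x).
  by rewrite dotvDr dotvZr di xi mulrN1 gtrDl oppr_lt0.
by apply: He; rewrite ?mem_enum //; apply: nactive_lt.
Qed.

(** A direction orthogonal to all active normals can be followed a little both ways. The functional
    exposing v is then constant along it, so uniqueness of the maximum makes the direction zero. *)
Lemma vertex_polyhedronP v :
  vertex polyhedron v <-> polyhedron v /\ spanning_normals (active v).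
Proof.
split=> [fv|[Pv sp]].
  have Pv : polyhedron v by apply: (face_sub fv).
  split=> // d dv; move: fv => /faceP[c [k [Hc Ev]]].
  have cv : dotv c v = k by have : [set v] v by []; rewrite Ev => -[].
  have step (f : 'rV[R]_n) : (forall i, i \in active v -> dotv (a i) f = 0) ->
      exists2 e, 0 < e & polyhedron (v + e *: f).
    move=> fv; have [e e0 He] := exists_small_step (enum I) a b v f.
    exists e => // i; have [iv|iv] := boolP (i \in active v).
      by rewrite dotvDr dotvZr fv // mulr0 addr0.
    by apply: ltW; apply: He; rewrite ?mem_enum //; apply: nactive_lt.
  have [e e0 /[dup] Pe /Hc] := step d dv.
  have [|e' e'0 /[dup] Pe' /Hc] := step (- d).
    by move=> i iv; rewrite dotvNr dv ?oppr0.
  rewrite !dotvDr !dotvZr !dotvNr cv !gerDl mulrN oppr_le0 pmulr_rge0 // pmulr_rle0 //.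
  move=> h1 h2; have cd : dotv c d = 0 by lra.
  have : [set v] (v + e *: d).
    by rewrite Ev; split=> //; rewrite dotvDr dotvZr cd mulr0 addr0.
  move=> /= /eqP; rewrite -subr_eq0 addrC addKr scaler_eq0 (gt_eqF e0) /=.
  by move/eqP.
have := polyhedron_face (active v); rewrite /vertex.
suff -> : [set v] = [set x | polyhedron x /\ active v \subset active x] by [].
apply/seteqP; split=> x /= => [->|[Px vx]]; first by split.
apply/eqP; rewrite -subr_eq0; apply/eqP/sp => i iv.
rewrite dotvBr; move/activeP: (iv) => ->.
by have /activeP -> := fintype.subsetP vx i iv; rewrite subrr.
Qed.

End Polyhedra.

Section Polytopes.
Variables (R : realType) (n : nat) (I : finType) (a : I -> 'rV[R]_n) (b : I -> R).
Implicit Types (x y v w c d : 'rV[R]_n) (i j l : I) (A J : {set I}).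
Local Notation P := (polyhedron a b).
Local Notation active := (active a b).
Hypothesis bnd : bounded_normals a.

(** The ratio test of the simplex method: i is the first inequality met on the ray. *)
Lemma max_step x d : P x -> d != 0 ->
  exists (t : R) i, [/\ 0 <= t, P (x + t *: d), 0 < dotv (a i) d &
    i \in active (x + t *: d)].
Proof.
move=> Px d0.
have [l l0] : exists l, 0 < dotv (a l) d.
  apply: contrapT => /forallNP H; move/eqP: d0; apply; apply: bnd => i.
  by rewrite leNgt; apply/negP.
pose q i := (b i - dotv (a i) x) / dotv (a i) d.
case: (@Order.TotalTheory.arg_minP _ _ _ l (fun i => 0 < dotv (a i) d) q l0) => i i0 imin.
have t0 : 0 <= q i by rewrite divr_ge0 ?subr_ge0 ?(ltW i0).
exists (q i), i; split=> //; last first.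
  by apply/activeP; rewrite dotvDr dotvZr divfK ?gt_eqF // addrC subrK.
move=> j; rewrite dotvDr dotvZr -lerBrDl; have [j0|j0] := ltP 0 (dotv (a j) d).
  by rewrite -ler_pdivlMr //; apply: imin.
by apply: (@le_trans _ _ 0); [rewrite mulr_ge0_le0|rewrite subr_ge0].
Qed.

(** Induction on the number of inactive inequalities. As long as the active normals do not span, a
    step orthogonal to them, with the sign for which c does not decrease, activates a further one
    and loses none. *)
Lemma vertex_above x c : P x ->
  exists w, [/\ vertex P w, active x \subset active w & dotv c x <= dotv c w].
Proof.
have [k] := ubnP #|~: active x|%SET; elim: k x => // k IH x Hk Px.
have [sp|/existsNP[d0 /not_implyP[Hd0 /eqP nd0]]] := pselect (spanning_normals a (active x)).
  by exists x; split=> //; apply/vertex_polyhedronP.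
have [d [nd Hd cd]] : exists d, [/\ d != 0, forall i, i \in active x -> dotv (a i) d = 0 &
    0 <= dotv c d].
  have [h|h] := leP 0 (dotv c d0); first by exists d0.
  exists (- d0); rewrite oppr_eq0 dotvNr oppr_ge0 (ltW h); split=> // i ix.
  by rewrite dotvNr Hd0 ?oppr0.
have [t [i [t0 Py id iy]]] := max_step Px nd.
set y := x + t *: d in Py iy.
have xy : active x \subset active y.
  apply/fintype.subsetP => j jx; apply/activeP.
  by rewrite dotvDr dotvZr Hd // mulr0 addr0; apply/activeP.
have nix : i \notin active x.
  by apply: contraTN id => /Hd ->; rewrite ltxx.
have [|//|w [vw yw cw]] := IH y.
  apply: leq_trans (_ : #|~: active x| <= k)%N => //.
  apply: proper_card; rewrite fintype.properE finset.setCS xy /=.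
  by apply/negP => /fintype.subsetP /(_ i); rewrite !inE; move: nix iy; rewrite !inE => -> -> /(_ isT).
exists w; split=> //; first exact: fintype.subset_trans xy yw.
by apply: le_trans cw; rewrite dotvDr dotvZr lerDl mulr_ge0.
Qed.

(** Independence provides a direction that leaves one facet j outside J and stays in the other
    facets through v. It ends on a facet not containing v, and climbing to a vertex from there keeps
    that facet. *)
Lemma other_vertex v J : vertex P v -> free_normals a (active v) ->
  J \proper active v -> exists w, [/\ vertex P w, w <> v & J \subset active w].
Proof.
move=> /vertex_polyhedronP[Pv sp] fv /properP[Jv [j jv jJ]].
have [d Hd] := free_normals_dual (fun i => if i == j then -1 else 0) fv.
have nd : d != 0.
  apply/eqP => d0; have := Hd j jv; rewrite eqxx d0 dotv0 => /eqP.
  by rewrite eq_sym oppr_eq0 oner_eq0.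
have [t [i [t0 Py id iy]]] := max_step Pv nd.
have [w [vw yw _]] := vertex_above 0 Py.
have niv : i \notin active v.
  by apply: contraTN id => /Hd ->; rewrite -leNgt; case: ifP => _ //; rewrite oppr_le0.
exists w; split=> //.
  by move=> wv; move: niv; rewrite -wv (fintype.subsetP yw).
apply: fintype.subset_trans yw; apply/fintype.subsetP => k kJ.
have kv := fintype.subsetP Jv k kJ.
apply/activeP; rewrite dotvDr dotvZr Hd // ifN ?mulr0 ?addr0; first exact/activeP.
by apply: contraNneq jJ => <-.
Qed.

(** If no inequality were tight on all of F, a generic point of F would satisfy all of them
    strictly. A functional maximal at such a point is constant on P, which makes F all of P. *)
Lemma proper_face_facet F : (0 < n)%N -> face P F -> F <> P ->
  exists i, F `<=` [set x | P x /\ dotv (a i) x = b i].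
Proof.
move=> n0 /faceP[c [k [Hc EF]]] nF.
have [F0|/set0P[x0 Fx0]] := eqVneq F set0.
  have [i|I0] := pickP (fun _ : I => true); first by exists i; rewrite F0 => x.
  have /rowP /(_ (Ordinal n0)) : const_mx 1 = 0 :> 'rV[R]_n.
    by apply: bnd => i; have := I0 i.
  by rewrite !mxE => /eqP; rewrite oner_eq0.
apply: contrapT => /forallNP nsub.
have Fconv x y : F x -> F y -> F (2^-1 *: (x + y)).
  rewrite EF /= => -[Px cx] [Py cy]; split; last by rewrite dotvZr dotvDr; lra.
  by move=> i; rewrite dotvZr dotvDr; have := Px i; have := Py i; lra.
have [||y Fy Hy] := @exists_generic_point _ _ _ (enum I) a b F Fconv.
- by exists x0.
- by move=> i x _ /[!EF] -[Px _].
have Py i : dotv (a i) y < b i.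
  move: (Fy); rewrite {1}EF => -[Py _]; rewrite lt_neqAle Py andbT; apply/eqP => Hi.
  have /existsNP[x /not_implyP[Fx]] := nsub i; apply; split; last first.
    by apply: Hy; rewrite ?mem_enum.
  by move: Fx; rewrite EF => -[].
have cy : dotv c y = k by move: Fy; rewrite EF => -[].
apply: nF; rewrite EF; apply/seteqP; split=> x /=; first by case.
move=> Px; split=> //; apply/eqP; rewrite eq_le Hc //=.
have [e e0 He] := exists_small_step (enum I) a b y (y - x).
have : P (y + e *: (y - x)).
  by move=> i; apply: ltW; apply: He; rewrite ?mem_enum.
move=> /Hc; rewrite dotvDr dotvZr dotvBr cy gerDl pmulr_rle0 //; lra.
Qed.

End Polytopes.

(* A nondegenerate halfspace description (a polytope which has one is simple)
   whose graph of intersecting facets is chordal. *)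
Definition chordal_rep (R : realType) (n : nat) (S : set 'rV[R]_n) : Prop :=
  exists (I : finType) (a : I -> 'rV[R]_n) (b : I -> R),
    [/\ S = polyhedron a b, S !=set0, bounded_normals a,
        forall x, S x -> free_normals a (active a b x) &
        chordal_graph (facets_touch a b)].

Lemma big_option (V : nmodType) (I : finType) (F : option I -> V) :
  \sum_o F o = F None + \sum_i F (Some i).
Proof.
rewrite (bigD1 None) //=; congr (_ + _).
rewrite (reindex_omap Some id) /=; last by case.
by apply: eq_bigl => i; rewrite eqxx.
Qed.

Lemma facets_touch_sym (R : realType) (n : nat) (I : finType) (a : I -> 'rV[R]_n)
  (b : I -> R) : symmetric (facets_touch a b).
Proof. by move=> i j; apply/asboolP/asboolP => -[x [? ? ?]]; exists x. Qed.

(** * Truncation of a vertex of a simple polytope *)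

Section Truncation.
Variables (R : realType) (n : nat) (I : finType) (a : I -> 'rV[R]_n) (b : I -> R).
Local Notation P := (polyhedron a b).
Hypotheses (n2 : (2 < n)%N) (bnd : bounded_normals a).
Hypothesis free : forall x, P x -> free_normals a (active a b x).
Variables (v c : 'rV[R]_n) (k : R).
Hypotheses (vv : vertex P v) (kv : k < dotv c v).
Hypothesis wk : forall w, w <> v -> vertex P w -> dotv c w < k.

Definition cut_normals (o : option I) := if o is Some i then a i else c.
Definition cut_bounds (o : option I) := if o is Some i then b i else k.
Local Notation P' := (polyhedron cut_normals cut_bounds).

Lemma cut_polyhedron : P `&` [set x | dotv c x <= k] = P'.
Proof.
apply/seteqP; split=> x /= => [[Px cx] [i|] //|H]; first exact: Px.
by split; [move=> i; exact: (H (Some i))|exact: (H None)].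
Qed.

Lemma cut_bounded : bounded_normals cut_normals.
Proof. by move=> d Hd; apply: bnd => i; exact: (Hd (Some i)). Qed.

Lemma cut_active_Some x i :
  (Some i \in active cut_normals cut_bounds x) = (i \in active a b x).
Proof. by rewrite !inE. Qed.

(** Normals active at a vertex span, and two vectors do not. *)
Lemma pair_proper_active i j : i \in active a b v -> j \in active a b v ->
  [set i; j]%SET \proper active a b v.
Proof.
move=> iv jv; rewrite fintype.properE; apply/andP; split.
  by apply/fintype.subsetP => l; rewrite inE => /orP[] /set1P ->.
apply/negP => /fintype.subsetP H; have [Pv sp] := (vertex_polyhedronP a b v).1 vv.
have [d /eqP d0 [di dj]] := pair_normals_not_spanning a i j n2.
by apply: d0; apply: sp => l /H; rewrite inE => /orP[] /set1P ->.
Qed.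

(** No vertex of P has c-value exactly k. For x on the cut, take a vertex w on all old facets
    through x. Then w - x is orthogonal to their normals but not to c, so pairing a relation with w
    - x kills the coefficient of c. *)
Lemma cut_free x : P' x -> free_normals cut_normals (active cut_normals cut_bounds x).
Proof.
move=> P'x; have [Px cx] : P x /\ dotv c x <= k by move: P'x; rewrite -cut_polyhedron.
move=> f; rewrite big_mkcond big_option /=.
under eq_bigr => i _ do rewrite cut_active_Some.
rewrite -big_mkcond /= => Hf.
have f0 : (if None \in active cut_normals cut_bounds x then f None *: c else 0) = 0.
  case: ifP Hf => // Nx Hf.
  have cxk : dotv c x = k by move: Nx => /activeP.
  have [w [vw xw cw]] := vertex_above bnd c Px.
  have : dotv c w != k.
    have [->|/eqP wv] := eqVneq w v; first by rewrite gt_eqF.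
    by rewrite lt_eqF ?wk.
  suff : f None * (dotv c w - k) = 0.
    move=> /eqP; rewrite mulf_eq0 subr_eq0 => /orP[/eqP -> _|-> //].
    by rewrite scale0r.
  have := congr1 (fun u => dotv u (w - x)) Hf.
  rewrite dotvDl dotvZl dot0v dotv_suml big1 ?addr0 => [|i ix].
    by rewrite dotvBr cxk.
  rewrite dotvZl dotvBr; have /activeP -> := ix.
  by have /activeP -> := fintype.subsetP xw i ix; rewrite subrr mulr0.
move: Hf; rewrite f0 add0r => Hf [i|]; last first.
  move=> Nx; move: f0; rewrite Nx => /eqP; rewrite scaler_eq0 => /orP[/eqP //|/eqP c0].
  have [cv cw] : dotv c v = 0 /\ k = 0.
    by move: Nx => /activeP /=; rewrite c0 !dot0v.
  by move: kv; rewrite cv cw ltxx.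
by rewrite cut_active_Some => ix; apply: (free Px Hf).
Qed.

Lemma cut_nonempty : P' !=set0.
Proof.
have [Pv sp] := (vertex_polyhedronP a b v).1 vv.
have [w [vw wv _]] : exists w, [/\ vertex P w, w <> v & finset.set0 \subset active a b w].
  apply: (other_vertex bnd vv (free Pv)); rewrite finset.proper0.
  have n0 : (0 < n)%N by lia.
  apply/eqP => v0; have /rowP /(_ (Ordinal n0)) : const_mx 1 = 0 :> 'rV[R]_n.
    by apply: sp => i; rewrite v0 inE.
  by rewrite !mxE => /eqP; rewrite oner_eq0.
exists w; rewrite -cut_polyhedron; split; last exact/ltW/wk.
exact: ((vertex_polyhedronP a b w).1 vw).1.
Qed.

(** Facets that meet share a vertex, and if that vertex is v they share another one, which survives
    the cut. *)
Lemma cut_touch_Some i j :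
  facets_touch cut_normals cut_bounds (Some i) (Some j) = facets_touch a b i j.
Proof.
apply/asboolP/asboolP => [[x []]|[x [Px ix jx]]].
  by rewrite -cut_polyhedron !cut_active_Some => -[Px _] ix jx; exists x.
suff [w [vw wv iw jw]] : exists w,
    [/\ vertex P w, w <> v, i \in active a b w & j \in active a b w].
  exists w; rewrite !cut_active_Some -cut_polyhedron; split=> //.
  by split; [exact: ((vertex_polyhedronP a b w).1 vw).1|exact/ltW/wk].
have [w [vw /fintype.subsetP xw _]] := vertex_above bnd 0 Px.
have [wv|/eqP wv] := eqVneq w v; last by exists w; split=> //; apply: xw.
have [Pv _] := (vertex_polyhedronP a b v).1 vv.
have [|u [vu uv /fintype.subsetP iju]] := other_vertex bnd vv (free Pv) (J := [set i; j]%SET).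
  by apply: pair_proper_active; rewrite -wv; apply: xw.
by exists u; split=> //; apply: iju; rewrite !inE eqxx ?orbT.
Qed.

(** From a common point, climbing along c inside the old facets reaches a vertex of value at least
    k, and v is the only such vertex. *)
Lemma cut_touch_None i :
  facets_touch cut_normals cut_bounds None (Some i) -> i \in active a b v.
Proof.
move=> /asboolP[x []]; rewrite -cut_polyhedron cut_active_Some => -[Px _].
move=> /activeP /= cx ix; have [w [vw /fintype.subsetP xw cw]] := vertex_above bnd c Px.
have [<-|/eqP wv] := eqVneq w v; first exact: xw.
by have := wk wv vw; rewrite -cx ltNge cw.
Qed.

Lemma cut_chordal_rep : chordal_graph (facets_touch a b) ->
  chordal_rep (P `&` [set x | dotv c x <= k]).
Proof.
move=> ch; exists (option I), cut_normals, cut_bounds.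
rewrite cut_polyhedron; split=> //.
- exact: cut_nonempty.
- exact: cut_bounded.
- exact: cut_free.
apply: chordal_graph_simplicial_vertex ch.
- exact: facets_touch_sym.
- by move=> i j _; apply: cut_touch_Some.
- move=> i j _ /cut_touch_None iv /cut_touch_None jv; apply/asboolP; exists v.
  by split=> //; exact: ((vertex_polyhedronP a b v).1 vv).1.
Qed.

End Truncation.

(** * Convex hulls and simplices *)

Section ConvexHulls.
Variables (R : realType) (n : nat) (V : seq 'rV[R]_n).
Implicit Types (c x p : 'rV[R]_n).

(** Weights in [conv] depend on the point, not on its position in the list, so p gets the inverse of
    its multiplicity. *)
Lemma conv_point p : p \in V -> conv V p.
Proof.
move=> pV; pose k := (count_mem p V)%:R : R.
have k0 : k != 0 by rewrite pnatr_eq0 -lt0n -has_count has_pred1.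
have sumE (W : lmodType R) (F : 'rV[R]_n -> W) :
    \sum_(q <- V) (if q == p then k^-1 else 0) *: F q = F p.
  rewrite (bigID (pred1 p)) /= addrC big1 ?add0r => [|q /negPf ->]; last by rewrite scale0r.
  rewrite (eq_bigr (fun=> k^-1 *: F p)) => [|q /eqP ->]; last by rewrite eqxx.
  by rewrite big_const_seq iter_addr_0 -scaler_nat scalerA mulfV // scale1r.
exists (fun q => if q == p then k^-1 else 0); split.
- by move=> q; case: ifP => // _; rewrite invr_ge0 ler0n.
- rewrite -[RHS](sumE R^o (fun=> 1)); apply: eq_bigr => q _.
  by rewrite /GRing.scale /= mulr1.
- by rewrite sumE.
Qed.

Lemma conv_le c (d : R) x : (forall p, p \in V -> dotv c p <= d) -> conv V x ->
  dotv c x <= d.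
Proof.
move=> Hc [f [f0 f1 ->]]; rewrite dotv_sumr -[d]mul1r -f1 mulr_suml.
rewrite !big_seq; apply: ler_sum => p pV.
by rewrite dotvZr ler_wpM2l // Hc.
Qed.

(* Complementary slackness. *)
Lemma conv_eq_weights c (d : R) (f : 'rV[R]_n -> R) :
  (forall p, p \in V -> dotv c p <= d) ->
  (forall p, 0 <= f p) -> \sum_(p <- V) f p = 1 ->
  dotv c (\sum_(p <- V) f p *: p) = d ->
  forall p, p \in V -> dotv c p != d -> f p = 0.
Proof.
move=> Hc f0 f1 Hd.
have : \sum_(p <- V) f p * (d - dotv c p) = 0.
  rewrite (eq_bigr (fun p => f p * d - dotv c (f p *: p))); last first.
    by move=> p _; rewrite dotvZr mulrBr.
  by rewrite sumrB -mulr_suml f1 mul1r -dotv_sumr Hd subrr.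
move=> /eqP; rewrite big_seq psumr_eq0 => [/allP H p pV|p pV]; last first.
  by rewrite mulr_ge0 // subr_ge0 Hc.
have := H _ pV; rewrite pV /= mulf_eq0 subr_eq0 => /orP[/eqP //|/eqP ->].
by rewrite eqxx.
Qed.

End ConvexHulls.

Section Simplices.
Variables (R : realType) (n : nat) (v : 'I_n.+1 -> 'rV[R]_n).
Hypothesis indep : forall c : 'I_n.+1 -> R,
  \sum_i c i = 0 -> \sum_i c i *: v i = 0 -> forall i, c i = 0.

(** The slack of inequality i is the i-th barycentric coordinate. The rows (v i, 1) form an
    invertible matrix, and column i of its inverse consists of - a i and b i. *)
Lemma barycentric_coordinates : exists (a : 'I_n.+1 -> 'rV[R]_n) (b : 'I_n.+1 -> R),
  [/\ forall i j, b i - dotv (a i) (v j) = (i == j)%:R,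
      forall x, \sum_i (b i - dotv (a i) x) = 1 &
      forall x, \sum_i (b i - dotv (a i) x) *: v i = x].
Proof.
pose B := \matrix_i row_mx (v i) (const_mx 1 : 'M_1).
have sumB (u : 'rV_n.+1) : u *m B = row_mx (\sum_i u 0 i *: v i) (\sum_i u 0 i)%:M.
  rewrite mulmx_sum_row; under eq_bigr => i _ do rewrite rowK scale_row_mx.
  apply/rowP => j; rewrite summxE; case: (splitP j) => k kj.
    have -> : j = lshift 1 k by apply/val_inj.
    rewrite row_mxEl summxE; apply: eq_bigr => i _; by rewrite row_mxEl.
  have -> : j = rshift n k by apply/val_inj.
  rewrite row_mxEr !mxE (ord1 k) eqxx; apply: eq_bigr => i _.
  by rewrite row_mxEr !mxE mulr1.
have rB : row_free B.
  rewrite -kermx_eq0; apply/rowV0P => u /sub_kermxP; rewrite sumB.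
  rewrite -(row_mx0 _ 1 n 1) => /eq_row_mx[E1 /matrixP /(_ 0 0)].
  rewrite !mxE eqxx /= => E2.
  by apply/rowP => i; rewrite mxE (indep E2 E1).
have fB : row_full B by move: rB => /eqP rB; rewrite /row_full rB addn1.
pose L := pinvmx B.
have BL : B *m L = 1%:M by apply: mulmxVp.
have LB : L *m B = 1%:M by apply: mulVpmx.
pose a i := - (col i (usubmx L))^T; pose b i := dsubmx L 0 i.
have abE x : \row_i (b i - dotv (a i) x) = row_mx x (1%:M : 'M_1) *m L.
  apply/rowP => i; rewrite -[L]vsubmxK mul_row_col mul1mx mxE [RHS]mxE addrC.
  congr (_ + _); rewrite dotvNl opprK dotvC dotvE trmxK.
  by rewrite !mxE; apply: eq_bigr => j _; rewrite !mxE.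
have sumL x : row_mx x (1%:M : 'M_1) *m L *m B = row_mx x 1%:M.
  by rewrite -mulmxA LB mulmx1.
exists a, b; split=> [i j|x|x].
- have /rowP /(_ i) := abE (v j); rewrite mxE => ->.
  have -> : row_mx (v j) 1%:M = row j B.
    by rewrite rowK; congr row_mx; apply/matrixP => s t; rewrite !mxE !ord1.
  by rewrite -row_mul BL !mxE eq_sym.
- move: (sumL x); rewrite -abE sumB => /eq_row_mx[_ /matrixP /(_ 0 0)].
  rewrite !mxE eqxx /= !mulr1n => <-; by apply: eq_bigr => i _; rewrite mxE.
- move: (sumL x); rewrite -abE sumB => /eq_row_mx[E _]; rewrite -[RHS]E.
  by apply: eq_bigr => i _; rewrite mxE.
Qed.

Lemma simplex_vertices_inj : injective v.
Proof.
have [a [b [ab _ _]]] := barycentric_coordinates.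
move=> i j vij; apply/eqP; have := ab i j; rewrite -vij ab eqxx.
by case: eqP => // _ /eqP; rewrite oner_eq0.
Qed.

End Simplices.

Lemma conv_mapE (R : realType) (n : nat) (I : finType) (v : I -> 'rV[R]_n) :
  injective v -> conv (map v (enum I)) =
  [set x | exists k : I -> R, [/\ forall i, 0 <= k i, \sum_i k i = 1 &
     x = \sum_i k i *: v i]].
Proof.
move=> vinj; apply/seteqP; split=> x.
  move=> [c [c0 c1 ->]]; exists (c \o v).
  by split=> [i||]; rewrite ?big_map ?big_enum //= -?c1 ?big_map ?big_enum.
move=> [k [k0 k1 ->]]; exists (fun p => \sum_(i | v i == p) k i).
have E i : \sum_(j | v j == v i) k j = k i.
  by rewrite (eq_bigl (pred1 i)) ?big_pred1_eq // => j /=; rewrite (inj_eq vinj).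
split=> [p||]; first by rewrite sumr_ge0.
- by rewrite big_map big_enum /= -[RHS]k1; apply: eq_bigr.
- by rewrite big_map big_enum /=; apply: eq_bigr => i _; rewrite E.
Qed.

(** For n >= 2 any two facets contain the vertex opposite to a third one, so the graph of facets is
    complete. *)
Lemma simplex_chordal_rep (R : realType) (n : nat) (S : set 'rV[R]_n) :
  (1 < n)%N -> simplex_set S -> chordal_rep S.
Proof.
move=> n1 [v [indep ->]].
have [a [b [ab ab1 abv]]] := barycentric_coordinates indep.
have vinj := simplex_vertices_inj indep.
have vP j : polyhedron a b (v j).
  by move=> i; rewrite -subr_ge0 ab ler0n.
have avE i j : dotv (a i) (v j) = b i - (i == j)%:R by rewrite -(ab i j); ring.
have Sv j : conv (map v (enum 'I_n.+1)) (v j).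
  by apply: conv_point; rewrite map_f ?mem_enum.
have SE : conv (map v (enum 'I_n.+1)) = polyhedron a b.
  apply/seteqP; split=> x.
    move=> Sx i; apply: conv_le Sx => _ /mapP[j _ ->]; exact: vP.
  move=> Px; rewrite conv_mapE //; exists (fun i => b i - dotv (a i) x).
  by split=> [i||//]; rewrite ?subr_ge0 // ab1.
exists 'I_n.+1, a, b; split=> //.
- by exists (v ord0).
- move=> d Hd.
  have E i : b i - dotv (a i) d = b i - dotv (a i) 0 - dotv (a i) d.
    by rewrite dotv0 subr0.
  have s0 : \sum_i - dotv (a i) d = 0.
    have := ab1 d; under eq_bigr => i _ do rewrite E.
    by rewrite big_split /= ab1 => E1; apply: (addrI 1); rewrite E1 addr0.
  have d0 i : - dotv (a i) d = 0.
    move/eqP: s0; rewrite psumr_eq0 => [/allP H|j _]; last by rewrite oppr_ge0.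
    by apply/eqP; apply: H; rewrite mem_index_enum.
  rewrite -[LHS]abv -[RHS]abv; apply: eq_bigr => i _.
  by rewrite E d0 addr0.
- rewrite SE => x Px k Hk i ix.
  have [j jx] : exists j, j \notin active a b x.
    apply: contrapT => /forallNP H; have /eqP := ab1 x; rewrite big1 => [|j _].
      by rewrite eq_sym oner_eq0.
    have /negP := H j; rewrite negbK => /activeP ->; exact: subrr.
  (* Since j is inactive, v j - v i is orthogonal to every active normal except a i, with which it
     pairs to 1. *)
  have := congr1 (fun u => dotv u (v j - v i)) Hk; rewrite dot0v dotv_suml.
  rewrite (bigD1 i) //= big1 ?addr0 => [|l /andP[lx li]].
    rewrite dotvZl dotvBr !avE eqxx (negPf (_ : i != j)).
      by rewrite subr0 opprB addrC subrK mulr1.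
    by apply: contraNneq jx => <-.
  rewrite dotvZl dotvBr !avE (negPf li) (negPf (_ : l != j)) ?subrr ?mulr0 //.
  by apply: contraNneq jx => <-.
- case=> [x0 [s [s4 us cyc]]].
  have := cyc 0%N 2%N; rewrite /cyc_consec modn_small ?modn_small; try lia.
  case=> //; try lia; move=> + _.
  have : facets_touch a b (nth x0 s 0) (nth x0 s 2); last by move=> -> /(_ isT).
  set i := nth _ _ _; set j := nth _ _ _.
  have [l lij] : exists l : 'I_n.+1, l \notin [set i; j]%SET.
    apply: contrapT => /forallNP H.
    have : (#|[set: 'I_n.+1]%SET| <= #|[set i; j]%SET|)%N.
      by apply: subset_leq_card; apply/fintype.subsetP => l _; apply/negPn/negP/H.
    rewrite finset.cardsT card_ord cards2; case: (_ != _) => /=; lia.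
  apply/asboolP; exists (v l); split=> //; apply/activeP; rewrite avE.
    by move: lij; rewrite !inE eq_sym => /norP[/negPf -> _]; rewrite subr0.
  by move: lij; rewrite !inE orbC eq_sym => /norP[/negPf -> _]; rewrite subr0.
Qed.

Lemma truncated_chordal_rep (R : realType) (n k : nat) (S : set 'rV[R]_n) :
  (1 < n)%N -> (k = 0%N \/ (2 < n)%N) -> truncated k S -> chordal_rep S.
Proof.
move=> n1 kn tr; elim: tr kn => [S0 S0s _|{}k S0 v c d tr IH Sv dv dw kn].
  exact: simplex_chordal_rep.
have n2 : (2 < n)%N by case: kn.
have [|I [a [b [ES0 _ bnd free ch]]]] := IH; first by right.
by rewrite ES0 in Sv dw free *; apply: (cut_chordal_rep n2 bnd free Sv dv).
Qed.

(** The anti-isomorphism turns the vertex x into a facet of Q, given by an inequality g x. Two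
    vertices lie in a common proper face of the hull exactly when the two facets have a common
    point, so g embeds the 1-skeleton as an induced subgraph of the graph of facets. *)
Lemma antiiso_chordal (R : realType) (T : finType) (C : {set {set T}}) (n p : nat)
    (V : seq 'rV[R]_n) (phi : T -> 'rV[R]_n) (Q : set 'rV[R]_p) :
  (forall A B : {set T}, B \subset A -> A \in C -> B \in C) ->
  iso_boundary C V phi -> face_antiiso (conv V) Q ->
  (0 < p)%N -> chordal_rep Q -> chordal_complex C.
Proof.
move=> Cdown [phi_inj vertexC faceC] [f [fF fsurj fanti]] p0.
move=> [I [a [b [EQ Qn0 bnd free ch]]]].
have fV : face (conv V) (conv V) by left.
have f0 : face (conv V) set0 := face_set0 _.
have fmin : f (conv V) = set0.
  have [G [fG fGE]] := fsurj _ (face_set0 Q).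
  apply/seteqP; split=> //; rewrite -fGE; apply/(fanti _ _ fG fV).
  exact: face_sub.
have f_neq0 F : face (conv V) F -> F <> conv V -> f F <> set0.
  move=> fF' nF fF0; apply: nF; apply/seteqP; split; first exact: face_sub.
  by apply/(fanti _ _ fV fF'); rewrite fF0.
have f_inj F G : face (conv V) F -> face (conv V) G -> f F = f G -> F = G.
  by move=> fF1 fG1 E; apply/seteqP; split; [apply/(fanti F G fF1 fG1)|
    apply/(fanti G F fG1 fF1)]; rewrite E.
pose P x := [set x]%SET \in C.
have vx x : P x -> face (conv V) [set phi x].
  by move=> Px; apply/vertexC; exists x.
have fmax : f set0 = Q.
  have [G [fG fGE]] := fsurj Q (or_introl erefl).
  apply/seteqP; split; first exact: face_sub (fF _ f0).
  by rewrite -{1}fGE; apply/(fanti _ _ f0 fG).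
pose Fc i := [set y | Q y /\ dotv (a i) y = b i].
have FcE i : Fc i = [set y | polyhedron a b y /\ ([set i] : {set I})%SET \subset active a b y].
  apply/seteqP; rewrite /Fc EQ; split=> y /= [Qy].
    by move=> iy; split=> //; rewrite finset.sub1set; apply/activeP.
  by rewrite finset.sub1set => /activeP.
have faceFc i : face Q (Fc i) by rewrite FcE EQ; apply: polyhedron_face.
have Fc_neq i : Fc i <> Q.
  have [y Qy] := Qn0; have := free y Qy; rewrite EQ in Qy.
  move=> /(free_interior Qy)[z Hz] E.
  have : Fc i z by rewrite E EQ => j; apply/ltW.
  by move=> [_ zi]; have := Hz i; rewrite zi ltxx.
have facet x : P x -> exists i, f [set phi x] = Fc i.
  move=> Px; have fx := vx x Px.
  have nQ : f [set phi x] <> Q.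
    rewrite -fmax => /(f_inj _ _ fx f0) /seteqP[/(_ (phi x) erefl)].
    by [].
  have [i Hi] : exists i, f [set phi x] `<=` Fc i.
    have := fF _ fx; rewrite /Fc EQ => ffx.
    by apply: (proper_face_facet bnd p0 ffx); rewrite -EQ.
  (* Only an inclusion is known, as the representation may contain redundant inequalities. The face
     G mapped to [Fc i] lies in the point phi x, and it is not empty because [Fc i] is not Q. *)
  exists i; have [G [fG fGE]] := fsurj _ (faceFc i).
  have Gx : G `<=` [set phi x] by apply/(fanti _ _ fG fx); rewrite fGE.
  rewrite -fGE; congr f; apply/seteqP; split=> //.
  have [G0|/set0P[y Gy]] := eqVneq G set0.
    by case: (Fc_neq i); rewrite -fGE G0.
  by move=> _ ->; have := Gx y Gy => /= <-.
(* A default index, the value of g at elements that are not vertices of C. *)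
have [i0 _] : exists i, set0 `<=` Fc i.
  rewrite /Fc EQ; apply: (proper_face_facet bnd p0 (face_set0 _)).
  by have [y] := Qn0; rewrite EQ => Qy E; move: Qy; rewrite -E.
have /choice[g gE] : forall x, exists i, P x -> f [set phi x] = Fc i.
  move=> x; have [Px|nPx] := pselect (P x); last by exists i0.
  by have [i] := facet x Px; exists i.
apply: (chordal_graph_transfer (P := P) (g := g)) ch.
- move=> x y /andP[_]; apply: Cdown.
  by rewrite finset.sub1set !inE eqxx.
- move=> x y Px Py gxy; apply: phi_inj => //.
  have /seteqP[/(_ (phi x) erefl)] : [set phi x] = [set phi y].
    by apply: f_inj; rewrite ?gE ?gxy //; apply: vx.
  by [].
- move=> x y Px Py xy; rewrite /skel_edge xy /=.
  have Pxy z : z \in [set x; y]%SET -> [set z]%SET \in C.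
    by rewrite !inE => /orP[] /eqP ->.
  split.
    move=> /(faceC _ Pxy)[F [fF' nF EF]].
    have FP z : z \in [set x; y]%SET -> [set phi z] `<=` F.
      move=> zxy _ ->; have : (phi @` [set t | t \in [set x; y]%SET]) (phi z) by exists z.
      by rewrite -EF => -[].
    have /set0P[q fq] : f F != set0 by apply/eqP; apply: f_neq0.
    apply/asboolP; exists q; rewrite -EQ.
    have Fq z : z \in [set x; y]%SET -> Fc (g z) q.
      move=> zxy; rewrite -gE; last exact: Pxy.
      by have := fanti _ _ (vx _ (Pxy _ zxy)) fF' => -[+ _] => /(_ (FP z zxy)); apply.
    have [Qq gx] : Fc (g x) q by apply: Fq; rewrite !inE eqxx.
    have [_ gy] : Fc (g y) q by apply: Fq; rewrite !inE eqxx orbT.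
    by split=> //; apply/activeP.
  move=> /asboolP[q [Pq /activeP gx /activeP gy]]; rewrite -EQ in Pq.
  have [F [fF' FE]] := fsurj _ (faceI (faceFc (g x)) (faceFc (g y))).
  have xF : F (phi x).
    have /(fanti _ _ (vx x Px) fF') : f F `<=` f [set phi x].
      by rewrite FE gE // => z [].
    by apply.
  have yF : F (phi y).
    have /(fanti _ _ (vx y Py) fF') : f F `<=` f [set phi y].
      by rewrite FE gE // => z [].
    by apply.
  have nF : F <> conv V.
    move=> FV; have : f F q by rewrite FE.
    by rewrite FV fmin.
  (* F may have more vertices than the two given; together they form a face of C, and C is closed
     downwards. *)
  apply: (Cdown [set t | ([set t]%SET \in C) && `[< F (phi t) >]]%SET).
    by apply/fintype.subsetP => z; rewrite !inE => /orP[] /eqP ->; apply/andP; split=> //; apply/asboolP.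
  apply/faceC; first by move=> z; rewrite inE => /andP[].
  exists F; split=> //; apply/seteqP; split=> p'.
    move=> [/vertexC[z [Cz zp']] Fp']; exists z => //=.
    by rewrite inE Cz /=; apply/asboolP; rewrite zp'.
  move=> [z /=]; rewrite inE => /andP[Cz /asboolP Fz] <-; split=> //.
  by apply/vertexC; exists z.
Qed.

(** * Polar duality *)

Section Polar.
Variables (R : realType) (n : nat) (V : seq 'rV[R]_n).
Implicit Types (c x y p : 'rV[R]_n).

Definition polar : set 'rV[R]_n := [set y | forall p, p \in V -> dotv p y <= 1].

(** For nonempty V this says that 0 is an interior point of the hull. *)
Definition positively_spanning :=
  forall c, (forall p, p \in V -> dotv p c <= 0) -> c = 0.

Hypotheses (V0 : V != [::]) (posV : positively_spanning).

Lemma polar_conv_le y x : polar y -> conv V x -> dotv y x <= 1.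
Proof. by move=> Py; apply: conv_le => p pV; rewrite dotvC Py. Qed.

Lemma polar_conv_face y : polar y -> face (conv V) [set x | conv V x /\ dotv y x = 1].
Proof. by move=> Py; apply/faceP; exists y, 1; split=> // x; apply: polar_conv_le. Qed.

(** Otherwise -y is negative on V, hence zero. Thus the faces cut out at level 1 are proper. *)
Lemma polar_not1 y : exists2 p, p \in V & dotv p y <> 1.
Proof.
apply: contrapT => H.
have H1 p : p \in V -> dotv p y = 1.
  by move=> pV; apply: contrapT => h; apply: H; exists p.
have y0 : y = 0.
  by apply/eqP; rewrite -oppr_eq0; apply/eqP/posV => p pV; rewrite dotvNr H1 // oppr_le0.
have [p pV] : exists p, p \in V by case: V V0 => // p *; exists p; rewrite inE eqxx.
by have /eqP := H1 p pV; rewrite y0 dotv0 eq_sym oner_eq0.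
Qed.

(** The bound of a functional exposing F can be scaled to 1: if it were not positive, the functional
    would vanish and F would be everything. *)
Lemma proper_face_polar F : face (conv V) F -> F <> conv V ->
  exists2 y, polar y & F = [set x | conv V x /\ dotv y x = 1].
Proof.
move=> /faceP[c [d [Hc EF]]] nF.
have HV p : p \in V -> dotv c p <= d by move=> pV; apply/Hc/conv_point.
have d0 : 0 < d.
  rewrite ltNge; apply/negP => d0; apply: nF.
  have c0 : c = 0 by apply: posV => p pV; rewrite dotvC (le_trans (HV p pV)).
  have [p pV] : exists p, p \in V by case: V V0 => // p *; exists p; rewrite inE eqxx.
  have dE : d = 0 by apply/eqP; rewrite eq_le d0; have := HV p pV; rewrite c0 dot0v.
  by rewrite EF; apply/seteqP; split=> x /=; rewrite c0 dot0v dE // => -[].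
exists (d^-1 *: c).
  by move=> p pV; rewrite dotvZr dotvC ler_pdivrMl // mulr1 HV.
rewrite EF; apply/seteqP; split=> x /= [Sx]; rewrite dotvZl.
  by move=> ->; rewrite mulVf ?gt_eqF.
by move=> H; split=> //; rewrite -[d]mulr1 -H mulVKf ?gt_eqF.
Qed.

Lemma conv_face_generated F x : face (conv V) F -> F x ->
  exists f : 'rV[R]_n -> R, [/\ forall p, 0 <= f p, \sum_(p <- V) f p = 1,
    x = \sum_(p <- V) f p *: p & forall p, p \in V -> ~ F p -> f p = 0].
Proof.
move=> /faceP[c [d [Hc ->]]] [[f [f0 f1 xE]] cx]; exists f; split=> // p pV nF.
apply: (conv_eq_weights (c := c) (d := d) _ f0 f1) => //.
- by move=> q qV; apply/Hc/conv_point.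
- by rewrite -xE.
- by apply/eqP => cp; apply: nF; split=> //; apply: conv_point.
Qed.

(** A face goes to the points of the polar that have value 1 on its elements of V. Inclusions are
    reflected because a proper face is the level-1 set of a point of the polar, and a point of a
    face is a convex combination of the elements of V in that face. *)
Lemma polar_antiiso : face_antiiso (conv V) polar.
Proof.
exists (fun F => [set y | polar y /\ forall p, p \in V -> F p -> dotv p y = 1]); split.
- move=> F _; apply/faceP.
  exists (\sum_(p <- V | `[< F p >]) p), (\sum_(p <- V | `[< F p >]) 1).
  have le1 y : polar y -> forall p, p \in V -> `[< F p >] -> dotv p y <= 1.
    by move=> Py p pV _; apply: Py.
  split=> [y Py|]; first by rewrite dotv_suml big_seq_cond [leRHS]big_seq_cond;
    apply: ler_sum => p /andP[pV _]; apply: Py.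
  apply/seteqP; split=> y /= [Py] H; split=> //.
    rewrite dotv_suml big_seq_cond [RHS]big_seq_cond; apply: eq_bigr => p.
    by move=> /andP[pV /asboolP Fp]; apply: H.
  move=> p pV Fp; move/esym/eqP: H; rewrite -subr_eq0 dotv_suml -sumrB big_seq_cond.
  rewrite psumr_eq0 => [/allP /(_ p pV)|q /andP[qV _]]; last by rewrite subr_ge0 Py.
  by rewrite pV /= asboolT //= subr_eq0 => /eqP.
- move=> G fG; have [G0|/set0P G0] := eqVneq G set0.
    exists (conv V); split; first by left.
    rewrite G0; apply/seteqP; split=> y //= [_ H].
    have [p pV] := polar_not1 y; apply; apply: H => //; exact: conv_point.
  have PG := face_sub fG.
  have Gconv x y : G x -> G y -> G (2^-1 *: (x + y)).
    move/faceP: fG => [c [d [_ ->]]] [Px cx] [Py cy]; split.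
      move=> p pV; rewrite dotvZr dotvDr; have := Px p pV; have := Py p pV; lra.
    by rewrite dotvZr dotvDr; lra.
  have [|z Gz Hz] := @exists_generic_point _ _ _ V id (fun=> 1) G Gconv G0.
    by move=> p y pV Gy; apply: PG.
  have Pz := PG z Gz.
  (* For z generic in G, all of G is tight wherever z is. Conversely, if y is tight there, a short
     step from z away from y stays in the polar, so the functional exposing G is maximal at y
     too. *)
  exists [set x | conv V x /\ dotv z x = 1]; split; first exact: polar_conv_face.
  apply/seteqP; split=> y /=; last first.
    move=> Gy; split; first exact: PG.
    by move=> p pV [_]; rewrite dotvC => zp; apply: (Hz p pV zp).
  move=> [Py Hy]; move: (fG) => /faceP[c [d [Hc EG]]].
  have cz : dotv c z = d by move: Gz; rewrite EG => -[].
  have [e e0 He] := exists_small_step V id (fun=> 1) z (z - y).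
  have : polar (z + e *: (z - y)).
    move=> p pV; have [zp|zp] := eqVneq (dotv p z) 1; last first.
      by apply/ltW/He; rewrite // lt_neqAle zp Pz.
    rewrite dotvDr dotvZr dotvBr zp Hy ?subrr ?mulr0 ?addr0 //.
    by split; [apply: conv_point|rewrite dotvC].
  move=> /Hc; rewrite dotvDr dotvZr dotvBr cz gerDl pmulr_rle0 // => h.
  by rewrite EG; split=> //; have := Hc y Py; lra.
- move=> F G fF fG; split=> [FG y [Py Hy]|H].
    by split=> // p pV Fp; apply: Hy => //; apply: FG.
  have [->|/eqP nG] := eqVneq G (conv V); first exact: face_sub.
  have [y Py EG] := proper_face_polar fG nG.
  have [_ Hy] : polar y /\ forall p, p \in V -> F p -> dotv p y = 1.
    by apply: H; split=> // p pV; rewrite EG dotvC => -[].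
  move=> x Fx; rewrite EG; split; first exact: face_sub fF _ Fx.
  have [f [f0 f1 -> fN]] := conv_face_generated fF Fx.
  rewrite dotv_sumr -f1 !big_seq; apply: eq_bigr => p pV; rewrite dotvZr.
  have [Fp|nFp] := pselect (F p); first by rewrite dotvC Hy // mulr1.
  by rewrite fN // mul0r.
Qed.

End Polar.

(** * Realizations recognised by tight sets *)

Section Realization.
Variables (R : realType) (n : nat) (T : finType) (C : {set {set T}}) (phi : T -> 'rV[R]_n).

Definition vertex_list := map phi (enum [pred x | [set x]%SET \in C]).
Local Notation V := vertex_list.

(** For y in the polar, these are the vertices on the face exposed by y at level 1. Comparing the
    sets with C is all that is checked about faces in each realization. *)
Definition tight y : {set T} := [set x | ([set x]%SET \in C) && (dotv (phi x) y == 1)]%SET.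

Hypothesis V0 : V != [::].
Hypothesis posV : positively_spanning V.
Hypothesis tightC : forall A : {set T}, A \in C <-> exists2 y, polar V y & A = tight y.
Hypothesis freeC : forall A : {set T}, A \in C -> forall k : T -> R,
  \sum_(x in A) k x *: phi x = 0 -> forall x, x \in A -> k x = 0.

Lemma vertex_listP p : reflect (exists2 x, [set x]%SET \in C & p = phi x) (p \in V).
Proof.
apply: (iffP mapP) => -[x Hx ->]; exists x => //; move: Hx; by rewrite mem_enum inE.
Qed.

Lemma vertex_list_inj x y :
  [set x]%SET \in C -> [set y]%SET \in C -> phi x = phi y -> x = y.
Proof.
move=> Cx Cy xy; have [z Pz E] := (tightC _).1 Cx.
have : x \in tight z by rewrite -E inE.
rewrite !inE Cx xy /= => yz; have : y \in tight z by rewrite inE Cy.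
by rewrite -E => /set1P.
Qed.

Lemma vertex_list_uniq : uniq V.
Proof.
rewrite map_inj_in_uniq ?enum_uniq // => x y; rewrite !mem_enum !inE.
exact: vertex_list_inj.
Qed.

(** An exposed point carries positive weight on an element of V, which must be itself. Conversely, a
    y with tight set {x} exposes a face on which phi x is the only element of V. *)
Lemma vertex_convP p : vertex (conv V) p <-> exists x, [set x]%SET \in C /\ phi x = p.
Proof.
split=> [vp|[x [Cx <-]]].
  have [f [f0 f1 pE fN]] := conv_face_generated vp (erefl : [set p] p).
  have [q qV fq] : exists2 q, q \in V & f q <> 0.
    apply: contrapT => H; have /eqP := f1; rewrite big_seq big1 => [|q qV].
      by rewrite eq_sym oner_eq0.
    by apply: contrapT => h; apply: H; exists q.
  have qp : q = p by apply: contrapT => h; apply: fq; apply: fN.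
  by move: qV; rewrite qp => /vertex_listP[x Cx ->]; exists x.
have [z Pz E] := (tightC _).1 Cx; rewrite /vertex.
have phiV : phi x \in V by apply/vertex_listP; exists x.
have zx : dotv z (phi x) = 1.
  have : x \in tight z by rewrite -E inE.
  by rewrite inE Cx /= dotvC => /eqP.
suff -> : [set phi x] = [set u | conv V u /\ dotv z u = 1] by apply: polar_conv_face.
apply/seteqP; split=> u /= => [->|[Su zu]]; first by split=> //; apply: conv_point.
have fz := polar_conv_face Pz; have [|f [f0 f1 uE fN]] := conv_face_generated fz (x := u).
  by split.
have fN' q : q \in V -> q != phi x -> f q = 0.
  move=> pV px; apply: fN => // -[_ zp]; move: px => /negP; apply; apply/eqP.
  move: pV => /vertex_listP[y Cy Ep]; rewrite Ep; congr phi; apply/set1P.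
  by rewrite E inE Cy dotvC -Ep zp eqxx.
have E1 : f (phi x) = 1.
  rewrite -f1 (bigD1_seq (phi x)) ?vertex_list_uniq //= big_seq_cond big1 ?addr0 // => q.
  by move=> /andP[pV px]; apply: fN'.
rewrite uE (bigD1_seq (phi x)) ?vertex_list_uniq //= big_seq_cond big1 ?addr0.
  by rewrite E1 scale1r.
by move=> q /andP[pV px]; rewrite fN' // scale0r.
Qed.

Lemma tight_vertices y : polar V y ->
  [set p | vertex (conv V) p /\ [set x | conv V x /\ dotv y x = 1] p] =
  phi @` [set x | x \in tight y].
Proof.
move=> Py; apply/seteqP; split=> p /=.
  move=> [/vertex_convP[x [Cx <-]] [_ yx]]; exists x => //=.
  by rewrite inE Cx dotvC yx eqxx.
move=> [x /=]; rewrite inE => /andP[Cx /eqP yx] <-.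
have vx : vertex (conv V) (phi x) by apply/vertex_convP; exists x.
split=> //; split; last by rewrite dotvC.
by apply/conv_point/vertex_listP; exists x.
Qed.

Lemma realization_iso : iso_boundary C V phi.
Proof.
split; [exact: vertex_list_inj|exact: vertex_convP|].
move=> A AC; split.
  move=> /tightC[y Py EA]; exists [set x | conv V x /\ dotv y x = 1]; split.
  - exact: polar_conv_face.
  - have [p pV np] := polar_not1 V0 posV y => E; apply: np.
    by have : conv V p by [apply: conv_point]; rewrite -E dotvC => -[].
  - by rewrite tight_vertices // EA.
move=> [F [fF nF EF]]; apply/tightC.
have [y Py EF'] := proper_face_polar V0 posV fF nF; exists y => //.
rewrite EF' tight_vertices // in EF.
have tC x : x \in tight y -> [set x]%SET \in C by rewrite inE => /andP[].
apply/finset.setP => x; apply/idP/idP => xA.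
  have : (phi @` [set t | t \in A]) (phi x) by exists x.
  by rewrite -EF => -[z /= zt] /(vertex_list_inj (tC z zt) (AC x xA)) <-.
have : (phi @` [set t | t \in tight y]) (phi x) by exists x.
by rewrite EF => -[z /= zt] /(vertex_list_inj (AC z zt) (tC x xA)) <-.
Qed.

(** The vertices on a proper face form a tight set, hence a face of C, and these are even linearly
    independent. *)
Lemma realization_simplicial : simplicial_polytope V.
Proof.
move=> F fF nF c _; have [y Py EF] := proper_face_polar V0 posV fF nF.
have tP x : ([set x]%SET \in C) && `[< vertex (conv V) (phi x) /\ F (phi x) >] = (x \in tight y).
  have /seteqP[E1 E2] := tight_vertices Py.
  apply/idP/idP => [/andP[Cx /asboolP]|xy].
    rewrite EF => /E1[z /= zt E]; rewrite -(vertex_list_inj _ Cx E) //.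
    by move: zt; rewrite inE => /andP[].
  rewrite (_ : _ \in C); last by move: xy; rewrite inE => /andP[].
  by apply/asboolP; rewrite EF; apply: E2; exists x.
rewrite undup_id ?vertex_list_uniq // big_map big_enum_cond /=.
under eq_bigl => x do rewrite inE tP.
move=> /(freeC (proj2 (tightC (tight y)) _)) H p /vertex_listP[x Cx ->] Hx.
apply: (H _ x); first by exists y.
by rewrite -tP Cx; apply/asboolP.
Qed.

End Realization.

(** * Realizations *)

(** The functional exposing v cannot decrease in both directions, so v + d attains the maximum as
    well. *)
Lemma vertex_no_segment (R : realType) (n : nat) (S : set 'rV[R]_n) v d :
  vertex S v -> S (v + d) -> S (v - d) -> d = 0.
Proof.
move=> /faceP[c [k [Hc Ev]]] /[dup] S1 /Hc + /Hc; rewrite dotvDr dotvBr.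
have cv : dotv c v = k by have : [set v] v by []; rewrite Ev => -[].
rewrite cv => h1 h2; have : [set v] (v + d) by rewrite Ev; split=> //; rewrite dotvDr; lra.
by move=> /= /eqP; rewrite -subr_eq0 addrC addKr => /eqP.
Qed.

(** * A simplex with some of its vertices cut off *)

Section CutSimplex.
Variables (R : realType) (n : nat).
Hypothesis n0 : (0 < n)%N.
Implicit Types (s t : 'I_n.+1) (x y d w : 'rV[R]_n) (l : seq 'I_n.+1).

(* The standard basis vectors and minus their sum. *)
Definition simplex_normal i : 'rV[R]_n :=
  \row_j ((i == lift ord_max j)%:R - (i == ord_max)%:R).
Local Notation p := simplex_normal.

Lemma simplex_normal_lift j y : dotv (p (lift ord_max j)) y = y 0 j.
Proof.
rewrite /dotv (bigD1 j) //= big1 ?addr0 => [|k kj].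
  by rewrite mxE eqxx eq_sym (negPf (neq_lift _ _)) subr0 mul1r.
rewrite mxE (inj_eq (@lift_inj _ _)) eq_sym (negPf kj).
by rewrite eq_sym (negPf (neq_lift _ _)) subr0 mul0r.
Qed.

Lemma simplex_normal_max y : dotv (p ord_max) y = - \sum_j y 0 j.
Proof.
rewrite -sumrN; apply: eq_bigr => j _.
by rewrite mxE eqxx (negPf (neq_lift _ _)) sub0r mulN1r.
Qed.

Lemma sum_ord_max (F : 'I_n.+1 -> R) :
  \sum_i F i = F ord_max + \sum_j F (lift ord_max j).
Proof.
rewrite (bigD1 ord_max) //=; congr (_ + _).
rewrite (reindex_omap (lift ord_max) (unlift ord_max)) /=.
  by apply: eq_bigl => j; rewrite liftK eqxx eq_sym neq_lift.
by move=> i; case: unliftP => [j ->|->] //=; rewrite eqxx.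
Qed.

Lemma sum_simplex_normal y : \sum_i dotv (p i) y = 0.
Proof.
rewrite sum_ord_max /= simplex_normal_max.
by under eq_bigr => j _ do rewrite simplex_normal_lift; rewrite addNr.
Qed.

Lemma simplex_normal_solve (mu : 'I_n.+1 -> R) : \sum_i mu i = 0 ->
  exists y, forall i, dotv (p i) y = mu i.
Proof.
rewrite sum_ord_max => /eqP; rewrite addr_eq0 => /eqP mu0.
exists (\row_j mu (lift ord_max j)) => i.
case: (unliftP ord_max i) => [j ->|->]; first by rewrite simplex_normal_lift mxE.
by rewrite simplex_normal_max mu0; congr (- _); apply: eq_bigr => j _; rewrite mxE.
Qed.

Lemma simplex_normal_eq0 y : (forall i, dotv (p i) y = 0) -> y = 0.
Proof. by move=> H; apply/rowP => j; rewrite mxE -simplex_normal_lift. Qed.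

Lemma simplex_normal_eq x y : (forall i, dotv (p i) x = dotv (p i) y) -> x = y.
Proof.
move=> H; apply/eqP; rewrite -subr_eq0; apply/eqP/simplex_normal_eq0 => i.
by rewrite dotvBr H subrr.
Qed.

(** The slacks are n + 1 times the barycentric coordinates in the simplex <p i, y> <= 1; they serve
    as coordinates from here on. *)
Lemma sum_slack y : \sum_i (1 - dotv (p i) y) = n.+1%:R.
Proof. by rewrite sumrB sum_simplex_normal subr0 big_const_ord iter_addr_0. Qed.

Lemma slack_solve (la : 'I_n.+1 -> R) : \sum_i la i = n.+1%:R ->
  exists y, forall i, 1 - dotv (p i) y = la i.
Proof.
move=> Hla; have [|y Hy] := simplex_normal_solve (mu := fun i => 1 - la i).
  by rewrite sumrB Hla big_const_ord iter_addr_0 subrr.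
by exists y => i; rewrite Hy; ring.
Qed.

(** Up to scaling, the only relation is that the normals sum to zero. The test vector y has value 1
    on p i, -1 on p j and 0 on the others. *)
Lemma simplex_normal_relation (k : 'I_n.+1 -> R) :
  \sum_i k i *: p i = 0 -> forall i j, k i = k j.
Proof.
move=> Hk i j; have [->//|ij] := eqVneq i j.
pose mu m : R := (m == i)%:R - (m == j)%:R.
have sumd k' : \sum_m (m == k')%:R = 1 :> R.
  by rewrite (bigD1 k') //= eqxx big1 ?addr0 // => m /negPf ->.
have [|y Hy] := simplex_normal_solve (mu := mu); first by rewrite sumrB !sumd subrr.
have := congr1 (fun u => dotv u y) Hk; rewrite dot0v dotv_suml.
rewrite (bigD1 i) //= (bigD1 j) /= 1?eq_sym //; rewrite big1 => [|l /andP[li lj]].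
  rewrite !dotvZl !Hy /mu !eqxx (eq_sym j) (negPf ij) /= => h; lra.
by rewrite dotvZl Hy /mu (negPf li) (negPf lj) subrr mulr0.
Qed.

Variable r : R.
Hypotheses (r_lt : r < n%:R) (r_gt : n%:R - 1 < r * 2).

(** At the vertex opposite to facet s the quantity - <p s, y> is n, so r < n makes the inequality
    cut it off. On the simplex two such quantities add up to at most n - 1, so n - 1 < 2 r keeps
    different cuts apart. *)
Definition cut_simplex l : set 'rV[R]_n :=
  [set y | (forall i, dotv (p i) y <= 1) /\ forall s, s \in l -> - dotv (p s) y <= r].

Lemma cut_cst_gt0 : 0 < r.
Proof.
have : (1 : R) <= n%:R by rewrite ler1n.
by move: r_gt r_lt; lra.
Qed.

Lemma slack_le (y : 'rV[R]_n) i : (forall j, dotv (p j) y <= 1) -> - dotv (p i) y <= n%:R.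
Proof.
move=> Hy; have := sum_slack y; rewrite (bigD1 i) //=.
have : 0 <= \sum_(j | j != i) (1 - dotv (p j) y) by apply: sumr_ge0 => j _; rewrite subr_ge0.
by rewrite -natr1; lra.
Qed.

Lemma slack2_le (y : 'rV[R]_n) i j : i != j -> (forall m, dotv (p m) y <= 1) ->
  - dotv (p i) y - dotv (p j) y <= n%:R - 1.
Proof.
move=> ij Hy; have := sum_slack y; rewrite (bigD1 i) //= (bigD1 j) /= 1?eq_sym //.
have : 0 <= \sum_(m | (m != i) && (m != j)) (1 - dotv (p m) y).
  by apply: sumr_ge0 => l _; rewrite subr_ge0.
by rewrite -natr1; lra.
Qed.

Lemma exists_opposite_vertex s :
  exists y, forall i, dotv (p i) y = 1 - (i == s)%:R * n.+1%:R.
Proof.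
have [|y Hy] := slack_solve (la := fun i => (i == s)%:R * n.+1%:R).
  by rewrite -mulr_suml (bigD1 s) //= eqxx big1 ?addr0 ?mul1r // => i /negPf ->.
by exists y => i; rewrite -Hy; ring.
Qed.

Lemma cut_simplex_nil : simplex_set (cut_simplex [::]).
Proof.
have /choice[v Hv] := exists_opposite_vertex.
have n1 : (n.+1%:R : R) != 0 by rewrite pnatr_eq0.
have dot_sum (c : 'I_n.+1 -> R) j :
    dotv (p j) (\sum_i c i *: v i) = \sum_i c i - c j * n.+1%:R.
  rewrite dotv_sumr; under eq_bigr => i _ do rewrite dotvZr Hv mulrBr mulr1.
  rewrite sumrB; congr (_ - _); rewrite (bigD1 j) //= eqxx mul1r big1 ?addr0 // => i.
  by rewrite eq_sym => /negPf ->; rewrite mul0r mulr0.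
have indep (c : 'I_n.+1 -> R) : \sum_i c i = 0 -> \sum_i c i *: v i = 0 -> forall i, c i = 0.
  move=> c0 cv i; have := dot_sum c i; rewrite cv dotv0 c0 sub0r => /eqP.
  by rewrite eq_sym oppr_eq0 mulf_eq0 (negPf n1) orbF => /eqP.
exists v; split=> //; rewrite (conv_mapE (simplex_vertices_inj indep)).
apply/seteqP; split=> y /= => [[Hy _]|[k [k0 k1 ->]]]; last first.
  by split=> // i; rewrite dot_sum k1 gerBl mulr_ge0.
exists (fun i => (1 - dotv (p i) y) / n.+1%:R); split=> [i||].
- by rewrite divr_ge0 ?subr_ge0.
- by rewrite -mulr_suml sum_slack divff.
apply: simplex_normal_eq => i; rewrite dot_sum -mulr_suml sum_slack divff // divfK //.
by ring.
Qed.

(** The next cut must remove a single vertex of the polytope already cut. A point w on or beyond the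
    cut at s, other than the opposite vertex v, has positive slack at some t; exchanging slack
    between s and t moves w both ways, so w is not a vertex. *)
Lemma cut_simplex_truncated l : uniq l -> truncated (size l) (cut_simplex l).
Proof.
have r0 := cut_cst_gt0.
elim: l => [_|s l IH /= /andP[sl ul]]; first exact/Defs.trunc0/cut_simplex_nil.
have [v Hv] := exists_opposite_vertex s.
have Hvs : - dotv (p s) v = n%:R by rewrite Hv eqxx mul1r -natr1; ring.
have Hvt t : t != s -> dotv (p t) v = 1 by move=> /negPf ts; rewrite Hv ts mul0r subr0.
have Pv : cut_simplex l v.
  split=> [i|t tl].
    by rewrite Hv gerBl mulr_ge0.
  rewrite Hvt; last by apply: contraNneq sl => <-.
  by move: r0; lra.
have vE w : (forall t, t != s -> dotv (p t) w = 1) -> w = v.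
  move=> Hw; apply: simplex_normal_eq => i; have [->|ni] := eqVneq i s; last by rewrite Hw ?Hvt.
  have := sum_simplex_normal w; have := sum_simplex_normal v.
  rewrite !(bigD1 (P := predT) s) //= (eq_bigr (fun i => dotv (p i) w)); last first.
    by move=> t ts; rewrite Hw ?Hvt.
  by lra.
have vv : vertex (cut_simplex l) v.
  apply/faceP; exists (- p s), n%:R; split=> [y [Hy _]|].
    by rewrite dotvNl slack_le.
  apply/seteqP; split=> y /= => [->|[[Hy _]]]; first by rewrite dotvNl.
  rewrite dotvNl => ys; apply: vE => t ts; apply/eqP; rewrite eq_le Hy /=.
  have := @slack2_le y s t; rewrite eq_sym ts ys => /(_ isT Hy); lra.
have -> : cut_simplex (s :: l) = cut_simplex l `&` [set y | dotv (- p s) y <= r].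
  apply/seteqP; split=> y /=; rewrite dotvNl.
    move=> [Hy Hl]; split; last by apply: Hl; rewrite inE eqxx.
    by split=> // t tl; apply: Hl; rewrite inE tl orbT.
  move=> [[Hy Hl] Hs]; split=> // t; rewrite inE => /predU1P[-> //|]; exact: Hl.
apply: Defs.truncS (IH ul) vv _ _; first by rewrite dotvNl Hvs.
move=> w wv vw; rewrite dotvNl ltNge; apply/negP => ws; apply: wv; apply: vE => t ts.
have [Hw Hwl] := face_sub vw (erefl : [set w] w).
apply/eqP; rewrite eq_le Hw /= leNgt; apply/negP => wt.
have st := slack2_le (i := s) (j := t) _ Hw; rewrite eq_sym ts in st; have {}st := st isT.
(* The distances from w to facet t and to the cut at t. The second is positive because w lies on or
   beyond the cut at s and the cuts are apart. *)
pose e := Num.min (1 - dotv (p t) w) (r + dotv (p t) w).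
have e0 : 0 < e by rewrite lt_min; apply/andP; split; move: ws st r_gt; lra.
have e1 : e <= 1 - dotv (p t) w by rewrite ge_min lexx.
have e2 : e <= r + dotv (p t) w by rewrite ge_min lexx orbT.
pose mu i := e * ((i == s)%:R - (i == t)%:R).
have [|d Hd] := simplex_normal_solve (mu := mu).
  rewrite /mu -mulr_sumr sumrB.
  have sumd k : \sum_m (m == k)%:R = 1 :> R.
    by rewrite (bigD1 k) //= eqxx big1 ?addr0 // => m /negPf ->.
  by rewrite !sumd subrr mulr0.
have ds : dotv (p s) d = e by rewrite Hd /mu eqxx (eq_sym s) (negPf ts) /=; ring.
have dt : dotv (p t) d = - e by rewrite Hd /mu eqxx (negPf ts) /=; ring.
have dN i : i != s -> i != t -> dotv (p i) d = 0.
  by move=> /negPf i1 /negPf i2; rewrite Hd /mu i1 i2; ring.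
suff d0 : d = 0 by move: ds e0; rewrite d0 dotv0 => <-; rewrite ltxx.
apply: (vertex_no_segment vw).
- split=> i => [|il]; rewrite dotvDr.
    have [->|is_] := eqVneq i s; first by rewrite ds; move: e1 st ws r_gt; lra.
    have [->|it] := eqVneq i t; first by rewrite dt; move: e0 e1 st ws r_gt; lra.
    by rewrite dN // addr0.
  have is_ : i != s by apply: contraNneq sl => <-.
  have [it|it] := eqVneq i t; first by rewrite it dt; move: e2; lra.
  by rewrite dN // addr0 Hwl.
- split=> i => [|il]; rewrite dotvBr.
    have [->|is_] := eqVneq i s; first by rewrite ds; move: e0 st ws r_gt; lra.
    have [->|it] := eqVneq i t; first by rewrite dt; move: e0 e1 st ws r_gt; lra.
    by rewrite dN // subr0.
  have is_ : i != s by apply: contraNneq sl => <-.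
  have [it|it] := eqVneq i t; first by rewrite it dt; have := Hwl _ il; rewrite it; move: e0 e2; lra.
  by rewrite dN // subr0 Hwl.
Qed.

End CutSimplex.

(** * Bier spheres of complexes that contain all complements of pairs *)

Section BierRealization.
Variables (R : realType) (n : nat) (K : {set {set 'I_n.+1}}).
Hypotheses (n1 : (1 < n)%N) (Kc : simplicial_complex K)
  (KnT : K != powerset [set: 'I_n.+1]).
Hypothesis Kpairs : forall i j, i != j -> ~: [set i; j]%SET \in K.
Local Notation p := (@simplex_normal R n).
Local Notation T := ('I_n.+1 + 'I_n.+1)%type.

(* The facets of the simplex which are stellarly subdivided; dually, the
   vertices which are cut off. *)
Definition cut_set : {set 'I_n.+1} := [set s | ~: [set s] \notin K]%SET.

(** Any value strictly between (n - 1) / 2 and n would serve. *)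
Let r : R := n%:R - 2^-1.

(** The barycentre of the p i with i different from s is - p s / n, so r < n places the point of s'
    slightly beyond that facet. Its polar inequality is the cut at s. *)
Definition bier_point (x : T) : 'rV[R]_n :=
  match x with inl i => p i | inr s => - r^-1 *: p s end.

Let r_lt : r < n%:R. Proof. by rewrite /r; lra. Qed.
Let r_gt : n%:R - 1 < r * 2.
Proof.
have : (1 : R) < n%:R by rewrite ltr1n.
by rewrite /r; lra.
Qed.
Let n0 : (0 < n)%N. Proof. exact: ltnW. Qed.
Let r0 : 0 < r. Proof. by apply: (@cut_cst_gt0 R n). Qed.
Lemma pair_complex_set1 i : [set i]%SET \in K.
Proof.
have [j [k [ji ki jk]]] : exists j k : 'I_n.+1, [/\ j != i, k != i & j != k].
  have /card_gt1P[j [k [ji ki jk]]] : (1 < #|~: [set i]|)%N.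
    by rewrite cardsC1 card_ord.
  by exists j, k; split=> //; [move: ji|move: ki]; rewrite !inE.
apply: (complex_down Kc) (Kpairs jk).
by rewrite finset.sub1set !inE negb_or !(eq_sym i) ji ki.
Qed.

(** A set missing two points lies in the complement of a pair, so only the complements of single
    points are in doubt. *)
Lemma pair_complexP (I : {set 'I_n.+1}) :
  I \in K <-> I != [set: 'I_n.+1]%SET /\ forall s, I = ~: [set s]%SET -> s \notin cut_set.
Proof.
split=> [IK|[IT Is]].
  split; first by apply: contraTneq IK => ->; apply: complex_setT.
  by move=> s Es; rewrite inE negbK -Es.
have /existsP[i iI] : [exists i, i \notin I].
  rewrite -negb_forall; apply: contra IT => /forallP H.
  by apply/eqP/finset.setP => i; rewrite inE H.
have [E|/eqP nE] := eqVneq I (~: [set i]%SET).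
  by have := Is i E; rewrite inE negbK -E.
have /existsP[j /andP[jI ji]] : [exists j, (j \notin I) && (j != i)].
  apply: contraT; rewrite negb_exists => /forallP H; case: nE.
  apply/finset.setP => j; rewrite !inE; have := H j.
  have [->|ji] := eqVneq j i; first by rewrite (negPf iI).
  by rewrite andbT negbK.
apply: (complex_down Kc) (Kpairs ji).
apply/fintype.subsetP => k kI; rewrite !inE negb_or.
by apply/andP; split; [apply: contraNneq jI => <-|apply: contraNneq iI => <-].
Qed.

Lemma pair_complex_dualP (J : {set 'I_n.+1}) :
  ~: J \notin K <-> J = finset.set0 \/ exists2 s, s \in cut_set & J = [set s]%SET.
Proof.
split=> [JK|[->|[s + ->]]]; last 1 first.
- by rewrite inE.
- have [->|] := eqVneq J finset.set0; [by left|right].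
  have [s [sc Es]] : exists s, s \in cut_set /\ ~: J = ~: [set s]%SET.
    apply: contrapT => H; move/negP: JK; apply; apply/pair_complexP; split.
      by rewrite -finset.setC0 (inj_eq (@finset.setC_inj _)).
    by move=> s Es; apply/negP => sc; apply: H; exists s.
  by exists s => //; apply: finset.setC_inj.
- by rewrite finset.setC0 complex_setT.
Qed.

Local Notation V := (vertex_list (bier K) bier_point).

Let inV i : p i \in V.
Proof. by apply/vertex_listP; exists (inl i); rewrite ?bier_inl ?pair_complex_set1. Qed.

Lemma bier_pointsN0 : V != [::].
Proof. by apply/eqP => V0; have := inV ord0; rewrite V0. Qed.

Lemma bier_points_positive : positively_spanning V.
Proof.
move=> c Hc; apply: simplex_normal_eq0 => i.
have /eqP := sum_simplex_normal c.
rewrite -oppr_eq0 -sumrN psumr_eq0 => [/allP /(_ i)|j _]; last first.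
  by rewrite oppr_ge0 Hc.
by rewrite mem_index_enum oppr_eq0 => /(_ isT) /eqP.
Qed.

Lemma bier_polar : polar V = cut_simplex r (enum cut_set).
Proof.
have cutE y s : (dotv (bier_point (inr s)) y <= 1) = (- dotv (p s) y <= r).
  by rewrite /= scaleNr dotvNl dotvZl -mulrN ler_pdivrMl // mulr1.
apply/seteqP; split=> y /= Hy.
  split=> [i|s]; first exact: Hy.
  rewrite mem_enum inE => sK; rewrite -cutE; apply: Hy.
  by apply/vertex_listP; exists (inr s); rewrite ?bier_inr.
move=> q /vertex_listP[[i|s] + ->]; first by move=> _; apply: Hy.1.
rewrite bier_inr // cutE => sK; apply: Hy.2.
by rewrite mem_enum inE.
Qed.

Lemma tight_inl y i : (inl i \in tight (bier K) bier_point y) = (dotv (p i) y == 1).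
Proof. by rewrite inE bier_inl // pair_complex_set1. Qed.

Lemma tight_inr y s : (inr s \in tight (bier K) bier_point y) =
  (s \in cut_set) && (- dotv (p s) y == r).
Proof.
rewrite inE bier_inr // inE /= scaleNr dotvNl dotvZl -mulrN; congr andb.
have rn0 := lt0r_neq0 r0; apply/eqP/eqP => [h|->]; last by rewrite mulVf.
by rewrite -[LHS](mulVKf rn0) h mulr1.
Qed.

(** The slacks sum to n + 1, so they cannot all vanish, and they cannot be concentrated at a cut
    point s, where they are at most r + 1. Two cuts are never tight together, and a tight cut has
    nonzero slack. *)
Lemma bier_of_tight y : polar V y -> tight (bier K) bier_point y \in bier K.
Proof.
rewrite bier_polar => -[Hy Hcut]; rewrite bierE; apply/and3P; split.
- apply/pair_complexP; split.
    apply/eqP => /finset.setP E; have := sum_slack y; rewrite big1 => [/eqP|i _].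
      by rewrite eq_sym pnatr_eq0.
    have := E i; rewrite finset.in_set tight_inl finset.in_setT => /eqP ->; exact: subrr.
  move=> s /finset.setP E; apply/negP => sc.
  have := sum_slack y; rewrite (bigD1 s) //= big1 ?addr0 => [|i si].
    by have := Hcut s; rewrite mem_enum sc -natr1 => /(_ isT); move: r_lt; lra.
  by have := E i; rewrite finset.in_set tight_inl finset.in_setC finset.in_set1 si => /eqP ->; rewrite subrr.
- apply/pair_complex_dualP.
  have [|/finset.set0Pn[s]] := eqVneq [set s | inr s \in tight (bier K) bier_point y]%SET finset.set0.
    by left.
  rewrite finset.in_set tight_inr => /andP[sc /eqP ys]; right; exists s => //.
  apply/finset.setP => t; rewrite finset.in_set tight_inr finset.in_set1.
  have [->|ts] := eqVneq t s; first by rewrite ys eqxx andbT.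
  apply/negP => /andP[tc /eqP yt].
  by have := slack2_le ts Hy; rewrite yt ys; move: r_gt; lra.
- rewrite finset.disjoints_subset; apply/fintype.subsetP => i.
  rewrite finset.in_set tight_inl finset.in_setC finset.in_set tight_inr => /eqP ->.
  by rewrite negb_and; apply/orP; right; apply/eqP; move: r0; lra.
Qed.

(** The conditions on y in terms of slacks: facet i is tight when [la i] is 0, the cut at s when
    [la s] is r + 1. *)
Lemma exists_tight (A : {set T}) (la : 'I_n.+1 -> R) :
  \sum_i la i = n.+1%:R -> (forall i, 0 <= la i) ->
  (forall i, (la i == 0) = (inl i \in A)) ->
  (forall s, s \in cut_set -> la s <= r + 1) ->
  (forall s, (inr s \in A) = (s \in cut_set) && (la s == r + 1)) ->
  exists2 y, polar V y & A = tight (bier K) bier_point y.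
Proof.
move=> /slack_solve[y Hy] la0 laA la_le la_eq; exists y.
  rewrite bier_polar; split=> [i|s]; first by have := la0 i; rewrite -Hy subr_ge0.
  by rewrite mem_enum => /la_le; rewrite -Hy; lra.
apply/finset.setP => -[i|s].
  by rewrite tight_inl -laA -Hy subr_eq0 eq_sym.
rewrite tight_inr la_eq -Hy; congr andb.
by rewrite (addrC 1) (inj_eq (addIr 1)).
Qed.

Lemma sum_indicator (N : {set 'I_n.+1}) : \sum_i (i \in N)%:R = #|N|%:R :> R.
Proof.
rewrite -sum1_card natr_sum [RHS]big_mkcond.
by apply: eq_bigr => i _; case: (i \in N).
Qed.

Lemma tight_of_bier A : A \in bier K ->
  exists2 y, polar V y & A = tight (bier K) bier_point y.
Proof.
rewrite bierE; set I := finset _; set J := finset _ => /and3P[IK JK IJ].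
have AI i : (inl i \in A) = (i \in I) by rewrite finset.in_set.
have AJ s : (inr s \in A) = (s \in J) by rewrite finset.in_set.
clearbody I J; have [IT Ic] := (pair_complexP I).1 IK.
have [J0|[s sc Js]] := (pair_complex_dualP J).1 JK.
  have N0 : (0 < #|~: I|)%N.
    rewrite card_gt0 -finset.setCT (inj_eq (@finset.setC_inj _)).
    exact: IT.
  have N0R : 0 < #|~: I|%:R :> R by rewrite ltr0n.
  (* The total n + 1 is spread evenly over the complement of I. If this contains a cut point, it has
     at least two elements, so q <= (n + 1) / 2 < r + 1. *)
  pose q : R := n.+1%:R / #|~: I|%:R.
  have q0 : 0 < q by rewrite divr_gt0.
  have lt_q s : s \in cut_set -> (s \in ~: I)%:R * q < r + 1.
    move=> sc; have [|_] := boolP (s \in ~: I)%SET; last by rewrite mul0r; move: r0; lra.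
    rewrite mul1r inE => sI.
    have N2 : (1 < #|~: I|)%N.
      rewrite ltnNge; apply/negP => N1; suff /Ic : I = ~: [set s]%SET by rewrite sc.
      apply: finset.setC_inj; rewrite finset.setCK; apply/eqP; rewrite eq_sym eqEcard.
      by rewrite finset.sub1set inE sI cards1.
    apply: (@le_lt_trans _ _ (n.+1%:R / 2)).
      by rewrite ler_pM2l // lef_pV2 ?posrE // ler_nat.
    by rewrite -natr1; move: r_gt; lra.
  apply: (exists_tight (la := fun i => (i \in ~: I)%:R * q)).
  - by rewrite -mulr_suml sum_indicator mulrC divfK ?gt_eqF.
  - by move=> i; rewrite mulr_ge0 // ltW.
  - by move=> i; rewrite mulf_eq0 (gt_eqF q0) orbF AI inE pnatr_eq0 eqb0 negbK.
  - by move=> s sc; rewrite ltW ?lt_q.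
  - move=> s; rewrite AJ J0 inE; apply/esym/andP => -[sc /eqP E].
    by have := lt_q s sc; rewrite E ltxx.
pose N := ~: (s |: I)%SET.
have sI : s \notin I.
  apply: contraL IJ => sI; rewrite -setI_eq0; apply/finset.set0Pn; exists s.
  by rewrite inE sI Js inE eqxx.
have N0 : (0 < #|N|)%N.
  rewrite card_gt0; apply: contraTneq sc => N0; apply: Ic.
  apply/finset.setP => i; have /finset.setP /(_ i) := N0; rewrite !inE.
  by have [->|] := eqVneq i s; [rewrite (negPf sI)|move=> _ /negbFE].
have N0R : 0 < #|N|%:R :> R by rewrite ltr0n.
(* With slack r + 1 placed at s, the rest n - r is spread evenly over N. It is less than r + 1, so
   no second cut becomes tight. *)
pose q : R := (n%:R - r) / #|N|%:R.
have q0 : 0 < q by rewrite divr_gt0 // subr_gt0.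
have q_lt : q < r + 1.
  apply: (@le_lt_trans _ _ (n%:R - r)); last by move: r_gt; lra.
  rewrite ler_pdivrMr // ler_peMr ?ler1n //; move: r_lt; lra.
pose la i : R := (i == s)%:R * (r + 1) + (i \in N)%:R * q.
have la_s : la s = r + 1.
  by rewrite /la eqxx !inE eqxx /= mul0r mul1r addr0.
have la_N i : i != s -> la i = (i \notin I)%:R * q.
  by move=> /negPf is_; rewrite /la is_ mul0r add0r !inE is_.
apply: (exists_tight (la := la)).
- rewrite big_split /= -!mulr_suml sum_indicator mulrC -[X in _ + X]mulrC.
  rewrite (eq_bigr (fun i => (i \in [set s]%SET)%:R)) => [|i _]; last by rewrite inE.
  by rewrite sum_indicator cards1 mulr1 divfK ?gt_eqF // -natr1; ring.
- move=> i; apply: addr_ge0; apply: mulr_ge0; rewrite ?ler0n ?(ltW q0) //; move: r0; lra.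
- move=> i; rewrite AI; have [->|is_] := eqVneq i s.
    by rewrite la_s (negPf sI) gt_eqF // addr_gt0.
  by rewrite la_N // mulf_eq0 (gt_eqF q0) orbF pnatr_eq0 eqb0 negbK.
- move=> t tc; have [->|ts] := eqVneq t s; first by rewrite la_s.
  rewrite la_N //; case: (t \in I) => /=; last by rewrite mul1r ltW.
  by rewrite mul0r ltW // addr_gt0.
- move=> t; rewrite AJ Js inE; have [->|ts] := eqVneq t s; first by rewrite la_s eqxx sc.
  rewrite la_N //; apply/esym/andP => -[_ /eqP]; case: (t \in I) => /=.
    by rewrite mul0r => E; move: r0; lra.
  by rewrite mul1r => E; move: q_lt; rewrite E ltxx.
Qed.

Lemma bier_tightP (A : {set T}) :
  A \in bier K <-> exists2 y, polar V y & A = tight (bier K) bier_point y.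
Proof.
by split=> [/tight_of_bier//|[y Py ->]]; apply: bier_of_tight.
Qed.

(** As I is in K and the complement of J is not, some i0 lies in neither. A relation on A thus
    becomes a relation of the normals in which p i0 has coefficient 0, and all its coefficients are
    equal. *)
Lemma bier_points_free (A : {set T}) : A \in bier K -> forall k : T -> R,
  \sum_(x in A) k x *: bier_point x = 0 -> forall x, x \in A -> k x = 0.
Proof.
rewrite bierE => /and3P[IK JK IJ] k.
pose ka i := (if inl i \in A then k (inl i) else 0) -
  (if inr i \in A then k (inr i) * r^-1 else 0).
rewrite big_mkcond big_sumType /= => Hk.
have {}Hk : \sum_i ka i *: p i = 0.
  rewrite -[RHS]Hk -big_split; apply: eq_bigr => i _ /=; rewrite /ka scalerBl.
  by case: (inl i \in A); case: (inr i \in A);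
    rewrite ?scale0r ?subr0 ?addr0 ?sub0r ?add0r // scalerA mulrN scaleNr.
have [i0 i0I i0J] : exists2 i, inl i \notin A & inr i \notin A.
  apply: contrapT => H; move: JK; rewrite (_ : ~: _ = [set i | inl i \in A]%SET) ?IK //.
  apply/finset.setP => i; rewrite !inE; apply/idP/idP => [nJ|iA].
    by apply: contraT => nI; case: H; exists i.
  apply: contraL IJ => jA; rewrite -setI_eq0; apply/finset.set0Pn; exists i.
  by rewrite !inE iA.
have ka0 i : ka i = 0.
  by rewrite (simplex_normal_relation Hk i i0) /ka (negPf i0I) (negPf i0J) subrr.
have disj i : inl i \in A -> inr i \in A -> False.
  move=> iA jA; move: IJ; rewrite -setI_eq0 => /eqP/finset.setP/(_ i).
  by rewrite !inE iA jA.
move=> [i|i] iA; have := ka0 i; rewrite /ka iA.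
  by case: ifP => [jA|_]; [case: (disj i)|rewrite subr0].
case: ifP => [jA|_]; first by case: (disj i).
move=> /eqP; rewrite sub0r oppr_eq0 mulf_eq0 invr_eq0 (gt_eqF r0) orbF.
by move/eqP.
Qed.

Lemma bier_realization :
  exists (V : seq 'rV[R]_n) (phi : T -> 'rV[R]_n) (Q : set 'rV[R]_n),
    [/\ simplicial_polytope V, iso_boundary (bier K) V phi,
        truncated #|cut_set| Q & face_antiiso (conv V) Q].
Proof.
exists V, bier_point, (polar V); split.
- exact: realization_simplicial bier_pointsN0 bier_points_positive bier_tightP bier_points_free.
- exact: realization_iso bier_pointsN0 bier_points_positive bier_tightP.
- rewrite bier_polar cardE; apply: (cut_simplex_truncated n0 r_lt r_gt).
  exact: enum_uniq.
- exact: polar_antiiso bier_pointsN0 bier_points_positive.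
Qed.

End BierRealization.

(** * Exchanging a complex and its Alexander dual *)

Section Duality.
Variables (m : nat) (K : {set {set 'I_m}}).

Definition sum_swap (x : 'I_m + 'I_m) : 'I_m + 'I_m :=
  match x with inl i => inr i | inr i => inl i end.

Lemma sum_swapK : involutive sum_swap. Proof. by case. Qed.

Lemma bier_dual (A : {set 'I_m + 'I_m}) :
  (A \in bier K) = (sum_swap @^-1: A \in bier (alexander_dual K)).
Proof.
rewrite !bierE.
have E1 : [set i | inl i \in sum_swap @^-1: A]%SET = [set i | inr i \in A]%SET.
  by apply/finset.setP => i; rewrite !inE.
have E2 : [set i | inr i \in sum_swap @^-1: A]%SET = [set i | inl i \in A]%SET.
  by apply/finset.setP => i; rewrite !inE.
have dE (B : {set 'I_m}) : (B \in alexander_dual K) = (~: B \notin K)%SET.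
  by rewrite finset.in_set.
by rewrite E1 E2 disjoint_sym !dE finset.setCK negbK andbCA.
Qed.

Lemma skel_edge_bier_dual x y : skel_edge (bier (alexander_dual K)) x y =
  skel_edge (bier K) (sum_swap x) (sum_swap y).
Proof.
rewrite /skel_edge bier_dual (inj_eq (inv_inj sum_swapK)).
suff -> : sum_swap @^-1: [set sum_swap x; sum_swap y]%SET = [set x; y]%SET by [].
by apply/finset.setP => z; rewrite !inE !(inj_eq (inv_inj sum_swapK)).
Qed.

Lemma chordal_bier_dual :
  chordal_complex (bier K) -> chordal_complex (bier (alexander_dual K)).
Proof.
apply: (chordal_graph_transfer (P := fun=> True) (g := sum_swap)) => //.
- by move=> x y _ _; apply: inv_inj sum_swapK _ _.
- by move=> x y _ _ _; rewrite skel_edge_bier_dual.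
Qed.

Lemma iso_boundary_dual (R : realType) (n : nat) (V : seq 'rV[R]_n) phi :
  iso_boundary (bier (alexander_dual K)) V phi ->
  iso_boundary (bier K) V (phi \o sum_swap).
Proof.
have E1 x : ([set x]%SET \in bier K) = ([set sum_swap x]%SET \in bier (alexander_dual K)).
  rewrite bier_dual; suff -> : sum_swap @^-1: [set x]%SET = [set sum_swap x]%SET by [].
  apply/finset.setP => z; rewrite !inE.
  by rewrite -(inj_eq (inv_inj sum_swapK)) sum_swapK.
move=> [inj vert faces]; split.
- move=> x y; rewrite !E1 => Cx Cy /(inj _ _ Cx Cy); exact: inv_inj sum_swapK _ _.
- move=> p; rewrite vert; split=> -[x [Cx xp]]; exists (sum_swap x).
    by rewrite E1 /= sum_swapK.
  by rewrite -E1.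
move=> A HA; rewrite bier_dual faces => [|x]; last first.
  by rewrite inE => /HA; rewrite E1 sum_swapK.
suff -> : phi @` [set x | x \in sum_swap @^-1: A] = (phi \o sum_swap) @` [set x | x \in A] by [].
apply/seteqP; split=> _ [x /= xA <-]; exists (sum_swap x) => //=.
- by move: xA; rewrite inE.
- by rewrite sum_swapK.
- by rewrite inE sum_swapK.
Qed.

End Duality.

(** * The case m = 2: two points *)

Section TwoVertices.
Variables (K : {set {set 'I_2}}).
Hypotheses (Kc : simplicial_complex K) (KnT : K != powerset [set: 'I_2]).
Local Notation T := ('I_2 + 'I_2)%type.

Lemma setC_ord2 (i j : 'I_2) : i != j -> ~: [set j]%SET = [set i]%SET.
Proof.
by case: i => [[|[|]]] ?; case: j => [[|[|]]] ? // _; apply/finset.setP => -[[|[|]] ?];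
  rewrite // !inE.
Qed.

Lemma ord2_neq_rev (i : 'I_2) : i != rev_ord i.
Proof. by case: i => [[|[|]]]. Qed.

Lemma bier_ord2_no_edge x y : skel_edge (bier K) x y = false.
Proof.
have pairT (i j : 'I_2) : i != j -> [set i; j]%SET = [set: 'I_2]%SET.
  by move=> ij; rewrite -(setC_ord2 ij) finset.setUC finset.setUCr.
case: x y => [i|i] [j|j]; rewrite (bier_edgeE Kc KnT).
- by apply/negP => /andP[/pairT ->]; rewrite (negPf (complex_setT Kc KnT)).
- by apply/negP => /and3P[/setC_ord2 -> ->].
- by apply/negP => /and3P[/setC_ord2 -> ->].
- by apply/negP => /andP[/pairT ->]; rewrite finset.setCT (complex_set0 Kc).
Qed.

Lemma bier_ord2_chordal : chordal_complex (bier K).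
Proof.
move=> [x0 [s [s4 _ H]]]; have := H 0%N 1%N.
rewrite bier_ord2_no_edge /cyc_consec modn_small ?eqxx; last by lia.
by case; [lia|lia|by []|move=> _ /(_ isT)].
Qed.

(** For each i exactly one of i and the copy of the other point is a vertex, according to whether
    {i} is in K. *)
Definition bier_ord2_vertex (i : 'I_2) : T :=
  if [set i]%SET \in K then inl i else inr (rev_ord i).
Local Notation u := bier_ord2_vertex.

Lemma bier_ord2_vertexP x : reflect (exists i, x = u i) ([set x]%SET \in bier K).
Proof.
apply: (iffP idP) => [|[i ->]].
  case: x => i; rewrite ?(bier_inl Kc KnT) ?(bier_inr Kc) => Hi.
    by exists i; rewrite /u Hi.
  exists (rev_ord i); rewrite /u rev_ordK ifN //.
  have ii : rev_ord i != i by rewrite eq_sym ord2_neq_rev.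
  by rewrite -(setC_ord2 ii).
rewrite /u; case: ifPn => iK; first by rewrite (bier_inl Kc KnT).
by rewrite (bier_inr Kc) (setC_ord2 (ord2_neq_rev i)).
Qed.

Variable R : realType.

Definition bier_ord2_point (x : T) : 'rV[R]_1 :=
  simplex_normal R (match x with inl i => i | inr i => rev_ord i end).
Local Notation p := (@simplex_normal R 1).
Local Notation V := (vertex_list (bier K) bier_ord2_point).

Lemma bier_ord2_pointE i : bier_ord2_point (u i) = p i.
Proof. by rewrite /u; case: ifP => _ //=; rewrite /bier_ord2_point rev_ordK. Qed.

Lemma bier_ord2P (A : {set T}) :
  A \in bier K <-> A = finset.set0 \/ exists i, A = [set u i]%SET.
Proof.
split=> [AK|[->|[i ->]]]; last 1 first.
- by apply/bier_ord2_vertexP; exists i.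
- have [->|/finset.set0Pn[x xA]] := eqVneq A finset.set0; [by left|right].
  have Ax : A = [set x]%SET.
    apply/eqP; rewrite finset.eqEsubset finset.sub1set xA andbT.
    apply/fintype.subsetP => y yA; rewrite inE; apply: contraT => yx.
    have := bier_ord2_no_edge y x; rewrite /skel_edge yx /= => /negP; case.
    apply: (bier_down Kc) AK; apply/fintype.subsetP => z.
    by rewrite !inE => /orP[] /eqP ->.
  by move: AK; rewrite Ax => /bier_ord2_vertexP[i ->]; exists i.
- apply: (@bier_down _ _ Kc [set u ord0]%SET); first exact: finset.sub0set.
  by apply/bier_ord2_vertexP; exists ord0.
Qed.

Lemma ord2_sum (F : 'I_2 -> R) i : \sum_j F j = F i + F (rev_ord i).
Proof.
rewrite big_ord_recl big_ord1; case: i => [[|[|]] ?] //.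
  by congr (F _ + F _); apply: val_inj.
by rewrite addrC; congr (F _ + F _); apply: val_inj.
Qed.

Lemma bier_ord2_inV i : p i \in V.
Proof.
apply/vertex_listP; exists (u i); last by rewrite bier_ord2_pointE.
by apply/bier_ord2_vertexP; exists i.
Qed.

Lemma bier_ord2_tight y i : (u i \in tight (bier K) bier_ord2_point y) = (dotv (p i) y == 1).
Proof.
rewrite inE bier_ord2_pointE; case: bier_ord2_vertexP => //= -[].
by exists i.
Qed.

Lemma bier_ord2_realization :
  exists (V : seq 'rV[R]_1) (phi : T -> 'rV[R]_1) (Q : set 'rV[R]_1),
    [/\ simplicial_polytope V, iso_boundary (bier K) V phi,
        truncated 0 Q & face_antiiso (conv V) Q].
Proof.
have [m11 z2] : (-1 : R) <> 1 /\ (1 + 1 : R) <> 0 by split; lra.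
have V0 : V != [::].
  by apply/eqP => V0; have := bier_ord2_inV ord0; rewrite V0.
have posV : positively_spanning V.
  move=> c Hc; apply: simplex_normal_eq0 => i.
  have := sum_simplex_normal c; rewrite (ord2_sum _ i).
  by have := Hc _ (bier_ord2_inV i); have := Hc _ (bier_ord2_inV (rev_ord i)); lra.
have sol i : exists y : 'rV[R]_1, dotv (p i) y = 1 /\ dotv (p (rev_ord i)) y = -1.
  have [|y Hy] := simplex_normal_solve (mu := fun j : 'I_2 => if j == i then 1 else -1 : R).
    by rewrite (ord2_sum _ i) eqxx eq_sym (negPf (ord2_neq_rev i)) subrr.
  by exists y; rewrite !Hy eqxx eq_sym (negPf (ord2_neq_rev i)).
have ord2P (i j : 'I_2) : j = i \/ j = rev_ord i.
  have [->|] := eqVneq j i; [by left|move=> ji; right; apply: val_inj => /=].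
  by move: ji (ltn_ord i) (ltn_ord j); rewrite -val_eqE /=; lia.
(* The list of cuts is empty; 1/2 satisfies the bounds imposed on r when n = 1. *)
have polarE : polar V = cut_simplex 2^-1 [::].
  apply/seteqP; split=> y Hy; first by split=> // i; apply: Hy; apply: bier_ord2_inV.
  move=> q /vertex_listP[x + ->] => /bier_ord2_vertexP[i ->].
  by rewrite bier_ord2_pointE; apply: Hy.1.
have tightC (A : {set T}) : A \in bier K <->
    exists2 y, polar V y & A = tight (bier K) bier_ord2_point y.
  rewrite bier_ord2P; split=> [[->|[i ->]]|[y Py ->]].
  - exists 0; first by move=> q _; rewrite dotv0.
    by apply/finset.setP => x; rewrite !inE dotv0 eq_sym oner_eq0 andbF.
  - have [y [y1 y2]] := sol i; exists y.
      rewrite polarE; split=> // j; have [->|->] := ord2P i j; first by rewrite y1.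
      by rewrite y2; lra.
    apply/finset.setP => x; apply/finset.set1P/idP => [->|xt].
      by rewrite bier_ord2_tight y1.
    have /bier_ord2_vertexP[j Ex] : [set x]%SET \in bier K by move: xt; rewrite inE => /andP[].
    move: xt; rewrite Ex bier_ord2_tight; have [->//|->] := ord2P i j.
    by rewrite y2 => /eqP /m11.
  - have [|/finset.set0Pn[x xt]] := eqVneq (tight (bier K) bier_ord2_point y) finset.set0.
      by left.
    right; have /bier_ord2_vertexP[i Ex] : [set x]%SET \in bier K by move: xt; rewrite inE => /andP[].
    exists i; apply/finset.setP => z; apply/idP/finset.set1P => [zt|->]; last by rewrite -Ex.
    have /bier_ord2_vertexP[j Ez] : [set z]%SET \in bier K by move: zt; rewrite inE => /andP[].
    rewrite Ez; congr u; have [//|Ej] := ord2P i j.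
    move: xt zt; rewrite Ex Ez !bier_ord2_tight Ej => /eqP y1 /eqP y2.
    by have := sum_simplex_normal y; rewrite (ord2_sum _ i) y1 y2 => /z2.
have freeC (A : {set T}) : A \in bier K -> forall k : T -> R,
    \sum_(x in A) k x *: bier_ord2_point x = 0 -> forall x, x \in A -> k x = 0.
  move=> /bier_ord2P[-> k _ x|[i ->] k Hk x]; rewrite !inE // => /eqP ->.
  have [y [y1 _]] := sol i; move: Hk; rewrite big_set1 bier_ord2_pointE.
  by move=> /(congr1 (fun v => dotv v y)); rewrite dotvZl y1 mulr1 dot0v.
exists V, bier_ord2_point, (polar V); split.
- exact: realization_simplicial V0 posV tightC freeC.
- exact: realization_iso V0 posV tightC.
- rewrite polarE; apply: (@cut_simplex_truncated _ _ _ _ _ _ [::]) => //; lra.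
- exact: polar_antiiso.
Qed.

End TwoVertices.

Lemma chordal_bier_realization (R : realType) (n : nat) (K : {set {set 'I_n.+1}}) :
  (1 < n)%N -> simplicial_complex K -> K != powerset [set: 'I_n.+1] ->
  chordal_complex (bier K) ->
  exists k, [/\ (k <= n.+1)%N, (n = 2 -> k = 0)%N &
    exists (V : seq 'rV[R]_n) phi (Q : set 'rV[R]_n),
      [/\ simplicial_polytope V, iso_boundary (bier K) V phi,
        truncated k Q & face_antiiso (conv V) Q]].
Proof.
move=> n1 Kc KnT chK.
have pairs (L : {set {set 'I_n.+1}}) : simplicial_complex L ->
    L != powerset [set: 'I_n.+1] -> chordal_complex (bier L) ->
    (forall i j, i != j -> ~: [set i; j]%SET \in L) ->
    exists k, [/\ (k <= n.+1)%N, (n = 2 -> k = 0)%N &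
      exists (V : seq 'rV[R]_n) phi (Q : set 'rV[R]_n),
        [/\ simplicial_polytope V, iso_boundary (bier L) V phi,
          truncated k Q & face_antiiso (conv V) Q]].
  move=> Lc LnT chL Lp; exists #|cut_set L|; split.
  - by rewrite -[leqRHS]card_ord max_card.
  (* For m = 3 chordality has already put every edge into the complex, so nothing is cut. *)
  - move=> n2; subst n; apply/eqP; rewrite cards_eq0; apply/eqP/finset.setP => s.
    by rewrite !inE (chordal_ord3_edges Lc LnT chL Lp).
  - exact: bier_realization.
have [Kp|Kp] := chordal_pairs Kc KnT chK; first exact: pairs.
have [|k [kn k0 [V [phi [Q [H1 H2 H3 H4]]]]]] := pairs (alexander_dual K)
  (alexander_dual_complex Kc KnT) (alexander_dual_neqT Kc) (chordal_bier_dual chK).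
  by move=> i j ij; rewrite inE finset.setCK Kp.
exists k; split=> //; exists V, (phi \o @sum_swap _), Q; split=> //.
exact: iso_boundary_dual.
Qed.

Theorem mainTheorem15 (R : realType) (m : nat) (K : {set {set 'I_m}}) :
  (2 <= m)%N -> simplicial_complex K -> K != powerset [set: 'I_m] ->
  chordal_complex (bier K) <->
  exists (n : nat) (V : seq 'rV[R]_n) (phi : ('I_m + 'I_m)%type -> 'rV[R]_n),
    [/\ simplicial_polytope V, iso_boundary (bier K) V phi &
      [\/ m = 2%N /\ exists Q : set 'rV[R]_1, truncated 0%N Q /\ face_antiiso (conv V) Q,
          m = 3%N /\ exists Q : set 'rV[R]_2, truncated 0%N Q /\ face_antiiso (conv V) Q |
          (4 <= m)%N /\ exists k, (k <= m)%N /\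
             exists Q : set 'rV[R]_(m.-1), truncated k Q /\ face_antiiso (conv V) Q]].
Proof.
move=> m2 Kc KnT; split=> [chK|].
  case: m m2 K Kc KnT chK => [|[|[|n]]] // _ K Kc KnT chK.
    have [V [phi [Q [H1 H2 H3 H4]]]] := bier_ord2_realization Kc KnT R.
    by exists 1%N, V, phi; split=> //; constructor 1; split=> //; exists Q.
  have [k [kn k0 [V [phi [Q [H1 H2 H3 H4]]]]]] :=
    chordal_bier_realization R (isT : 1 < n.+2)%N Kc KnT chK.
  exists n.+2, V, phi; split=> //; case: n => [|n] in K Kc KnT chK k kn k0 V phi Q H1 H2 H3 H4 *.
    by constructor 2; split=> //; exists Q; move: H3; rewrite (k0 erefl).
  by constructor 3; split=> //; exists k; split=> //; exists Q.
have down := @bier_down _ _ Kc.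
move=> [n [V [phi [_ iso [[m2' _]|[m3 [Q [tQ aQ]]]|[m4 [k [_ [Q [tQ aQ]]]]]]]]]].
- by move: K Kc KnT {iso phi down m2}; rewrite m2' => K Kc KnT; apply: bier_ord2_chordal.
- apply: (antiiso_chordal down iso aQ) => //.
  by apply: truncated_chordal_rep tQ => //; left.
- apply: (antiiso_chordal down iso aQ); first by lia.
  by apply: truncated_chordal_rep tQ; [lia|right; lia].
Qed.
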